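(* Let $\alpha_0\in(0,2)$ be the unique root of the strictly increasing function $\alpha\mapsto\beta(\alpha)$ on $(-2,2)$ defined in the context. Then the Wente family $\mathcal W=\mathcal S^2_1\cap\mathbb R[\lambda]$ is the following connected non-compact $1$-dimensional submanifold of $\mathcal A_-$: $$\mathcal W=\big\{\lambda^4-(4+\alpha_0\alpha_+)\lambda^3+(6+2\alpha_0\alpha_++\alpha_+^2)\lambda^2-(4+\alpha_0\alpha_+)\lambda+1\ \big|\ \alpha_+\in\mathbb R_+\big\},$$ where $\mathbb R_+=(0,\infty)$.
   Context: For $d\in\mathbb N$ let $P^d_{\mathbb R}$ be the real vector space of polynomials $p\in\mathbb C[\lambda]$ of degree at most $d$ with $\lambda^d\,\overline{p(\bar\lambda^{-1})}=p(\lambda)$. Let $\mathcal H^2$ be the set of $a\in P^4_{\mathbb R}$ of degree $4$ such that $\lambda^{-2}a(\lambda)>0$ for $\lambda\in\mathbb S^1$, the roots of $a$ are pairwise distinct, and the highest coefficient of $a$ has absolute value $1$. For $a\in\mathcal H^2$ let $\Sigma_a$ be the compact genus $2$ Riemann surface given by $\nu^2=\lambda a(\lambda)$. For $b\in P^3_{\mathbb R}$ put $\Theta(b)=\frac{b(\lambda)}{\nu}\frac{d\lambda}{\lambda}$, and let $\mathcal B_a$ be the real vector space of $b\in P^3_{\mathbb R}$ such that all periods of $\Theta(b)$ on $\Sigma_a$ are purely imaginary. Set $\mathcal S^2_1=\{a\in\mathcal H^2\mid b(1)=0\text{ for all }b\in\mathcal B_a\}$. $\mathcal A_-$ is the connected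 component of $\mathcal H^2\cap\mathbb R[\lambda]$ (polynomials with real coefficients) whose elements have four different roots of the form $\alpha,\bar\alpha,\alpha^{-1},\bar\alpha^{-1}$ with $\alpha\in\mathbb C\setminus(\mathbb R\cup\mathbb S^1)$. For $\alpha\in(-2,2)$ there is a unique $\beta=\beta(\alpha)\in\mathbb R$ for which all periods of the meromorphic $1$-form $\frac{\varkappa^2+\beta}{\nu}\,d\varkappa$ on the elliptic curve $\nu^2=\varkappa^4+\alpha\varkappa^2+1$ are real. The function $\alpha\mapsto\beta(\alpha)$ is strictly increasing on $(-2,2)$ and has a unique root $\alpha_0$, which lies in $(0,2)$. *)

(* Defs.v *)
From mathcomp Require Import all_boot all_order all_algebra.
From mathcomp Require Import complex.
From mathcomp Require Import all_classical all_reals all_analysis.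

Set Implicit Arguments.
Unset Strict Implicit.
Unset Printing Implicit Defensive.

Import Order.TTheory GRing.Theory Num.Theory.
Import numFieldNormedType.Exports.

Local Open Scope classical_set_scope.
Local Open Scope complex_scope.
Local Open Scope ring_scope.

Definition P_R (R : realType) (d : nat) : set {poly R[i]} :=
  [set p : {poly R[i]} | (size p <= d.+1)%N /\
    forall l : R[i], l != 0 -> l ^+ d * (p.[(l^*)^-1])^* = p.[l]].

Definition H2 (R : realType) : set {poly R[i]} :=
  [set a : {poly R[i]} | [/\ P_R 4 a,
    size a = 5%N,
    forall l : R[i], `|l| = 1 -> 0 < l ^- 2 * a.[l],
    exists s : seq R[i],
      uniq s /\ a = lead_coef a *: \prod_(z <- s) ('X - z%:P) &
    `|lead_coef a| = 1]].

Definition real_poly (R : realType) : set {poly R[i]} :=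
  [set p : {poly R[i]} | forall i, complex.Im p`_i = 0].

(** * Periods on the curve [y ^+ 2 = f.[x]] *)

Definition C1 (R : realType) (g : R -> R) : Prop :=
  (forall t, derivable g t 1) /\ continuous (g^`())%classic.

Definition C1c (R : realType) (g : R -> R[i]) : Prop :=
  C1 (fun t => complex.Re (g t)) /\ C1 (fun t => complex.Im (g t)).

Definition derivec (R : realType) (g : R -> R[i]) (t : R) : R[i] :=
  (fun s => complex.Re (g s))^`()%classic t
  +i* (fun s => complex.Im (g s))^`()%classic t.

Definition integralc (R : realType) (g : R -> R[i]) : R[i] :=
  (\int[lebesgue_measure]_(t in `[0, 1]) complex.Re (g t))%R
  +i* (\int[lebesgue_measure]_(t in `[0, 1]) complex.Im (g t))%R.

(* Closed curves (x, y) on the affine curve y ^+ 2 = f.[x], parametrized by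
   [0, 1] and avoiding the ramification points y = 0. *)
Definition curve_loop (R : realType) (f : {poly R[i]}) (x y : R -> R[i]) :
    Prop :=
  [/\ C1c x, C1c y, x 0 = x 1, y 0 = y 1 &
    forall t, t \in `[0, 1] -> y t ^+ 2 = f.[x t] /\ y t != 0].

(* The periods of the meromorphic form h(x) dx / y on the compact Riemann
   surface of y ^+ 2 = f.[x], where the poles of h are zeros of f.  The finitely
   many points missed by curve_loop (those with y = 0, and those over infinity)
   do not change the periods: every homology class has representatives avoiding
   them, and, for the forms below, the residues there vanish.  C^1 loops suffice
   since corners can be removed by stopping there. *)
Definition period (R : realType) (f : {poly R[i]}) (h : R[i] -> R[i])
    (w : R[i]) : Prop :=
  exists x y : R -> R[i], curve_loop f x y /\
    w = integralc (fun t => h (x t) / y t * derivec x t).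

(* w is a period of Theta(b) = (b(l) / nu) (dl / l) on nu ^+ 2 = l * a(l) *)
Definition Theta_period (R : realType) (a b : {poly R[i]}) (w : R[i]) : Prop :=
  period ('X * a) (fun l => b.[l] / l) w.

Definition B_ (R : realType) (a : {poly R[i]}) : set {poly R[i]} :=
  [set b : {poly R[i]} | P_R 3 b /\ forall w, Theta_period a b w -> complex.Re w = 0].

Definition S21 (R : realType) : set {poly R[i]} :=
  [set a : {poly R[i]} | H2 a /\ forall b, B_ a b -> b.[1] = 0].

Definition Wente (R : realType) : set {poly R[i]} := @S21 R `&` @real_poly R.

(** * The topology of the real polynomials of degree at most 4 *)

(* This identifies the real polynomials of degree at most 4 with R^5; their
   subsets inherit the topology and the smooth structure of R^5 through it. *)
Definition coefv (R : realType) (p : {poly R[i]}) : 'rV[R]_5 :=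
  \row_(i < 5) complex.Re p`_i.

Definition H2R (R : realType) : set {poly R[i]} := @H2 R `&` @real_poly R.

Definition quad_roots (R : realType) (a : {poly R[i]}) : Prop :=
  exists z : R[i], [/\ complex.Im z != 0, `|z| != 1,
    uniq [:: z; z^*; z^-1; (z^*)^-1] &
    all (root a) [:: z; z^*; z^-1; (z^*)^-1]].

(* A is the connected component A_- of H2R. *)
Definition is_A_minus (R : realType) (A : set {poly R[i]}) : Prop :=
  [/\ A `<=` @H2R R,
    exists2 a, H2R a &
      @coefv R @` A = connected_component (@coefv R @` @H2R R) (coefv a) &
    forall a, A a -> quad_roots a].

Definition smooth_curve (R : realType) (n : nat) (g : R -> 'rV[R]_n.+1) :
    Prop :=
  forall (k : nat) (t : R), derivable (g^`(k))%classic t 1.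

(* Embedded one-dimensional submanifolds, by local parametrizations: smooth
   immersions of R that are homeomorphisms onto relatively open subsets of M. *)
Definition submanifold1 (R : realType) (n : nat) (M : set 'rV[R]_n.+1) :
    Prop :=
  forall p, M p -> exists (U : set 'rV[R]_n.+1) (g : R -> 'rV[R]_n.+1),
    [/\ open U /\ U p,
      smooth_curve g /\ (forall t, (g^`())%classic t != 0),
      injective g /\ range g = M `&` U &
      forall I : set R, open I -> exists2 V, open V & g @` I = M `&` V].

(** * The function beta *)

Definition elliptic_period (R : realType) (alpha beta : R) (w : R[i]) : Prop :=
  period ('X^4 + (alpha%:C)%:P * 'X^2 + 1) (fun k => k ^+ 2 + beta%:C) w.

Definition real_periods (R : realType) (alpha beta : R) : Prop :=
  forall w, elliptic_period alpha beta w -> complex.Im w = 0.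

Definition is_beta (R : realType) (beta : R -> R) : Prop :=
  forall alpha, -2 < alpha < 2 -> unique (real_periods alpha) (beta alpha).

Definition Wente_poly (R : realType) (alpha0 alphap : R) : {poly R[i]} :=
  'X^4 - ((4 + alpha0 * alphap)%:C)%:P * 'X^3
       + ((6 + 2 * alpha0 * alphap + alphap ^+ 2)%:C)%:P * 'X^2
       - ((4 + alpha0 * alphap)%:C)%:P * 'X + 1.

(* Main.v *)
Require Import Defs.
From mathcomp Require Import all_boot all_order all_algebra.
From mathcomp Require Import complex polydiv separable.
From mathcomp Require Import all_classical all_reals all_analysis.
From mathcomp Require Import ring lra.

(** Periods are tested on all loops and no homology basis is used, so each comparison of curves has
    to move an arbitrary loop. A square root continued along a loop may return with the opposite
    sign; a second turn closes it, and the doubled integral is harmless when only the vanishing of a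
    real part matters. Transfers therefore mostly run one way: to see that a form has imaginary
    periods, its loops are carried to a curve with real periods, and the change of variables
    contributes a factor i. The opposite direction is used for the explicit loop alone, where one
    extra point, l = -1, has to be avoided.

    The two inclusions use B_a differently. Excluding a polynomial takes a single b in B_a with b(1)
    nonzero. Membership concerns every b in B_a: conjugation reduces to real b, a multiple of the
    known element of B_a is subtracted, and what remains is a multiple of one holomorphic form,
    killed by a single period that is not imaginary. *)

(* Put x = (l - 1)^2 / l.  A real a in H^2 is eps l^2 (x^2 + p x + r), and with
   l = m^2, s = m - 1/m, N = nu / m^3 the form Theta of
   (l + 1) (u (l - 1)^2 + v l) is 2 (u s^2 + v) ds / N on
   N^2 = eps (s^4 + p s^2 + r).  Hence a lies in S^2_1 iff v = 0 for the form
   with u = 1 whose periods are imaginary.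

   If x^2 + p x + r has no real root, this quartic is a rescaling of the curve
   defining beta, and v = - sqrt r * beta (- p / sqrt r), so v = 0 singles out
   alpha0.  If the roots are real, one or two 2-isogenies w = s + sqrt (s^2 - e)
   lead to a curve with alpha = 2 - 4 q^2 in (-2, 2), and v = 0 would force
   beta = -1, beta = 1 or beta = 1 - 2 q.  This contradicts the bounds
   -1 < beta (2 - 4 q^2) < 1 - 2 q, which come from one explicit loop: a
   translate of the imaginary axis of the elliptic curve, avoiding infinity.  The
   same loop shows that the holomorphic form has a period that is not imaginary.

   Curves upstairs are reached by lifting square roots along loops run through
   twice; periods are handled as increments of primitives along paths.  In the
   parameters (p, r) the polynomials with four non-real roots form the convex set
   p^2 < 4 r, which is therefore contained in A_-. *)

Set Implicit Arguments.
Unset Strict Implicit.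
Unset Printing Implicit Defensive.

Import Order.TTheory GRing.Theory Num.Theory.
Import numFieldNormedType.Exports.

Local Open Scope classical_set_scope.
Local Open Scope complex_scope.
Local Open Scope ring_scope.

Local Notation Re := (@complex.Re _).
Local Notation Im := (@complex.Im _).

(** * Differentiable complex paths *)

Section ComplexPaths.
Variable R : realType.
Implicit Types f g h : R -> R[i].

(* A wrapper, since unification would unfold [continuous] to its quantifier. *)
Variant rcont (u : R -> R) : Prop := RCont of continuous u.

Lemma rcont_ext (u v : R -> R) : (forall t, u t = v t) -> rcont u -> rcont v.
Proof. by move=> /funext ->. Qed.

Lemma is_derive_ext (u v : R -> R) (t a b : R) : (forall t, u t = v t) ->
  a = b -> is_derive t 1 u a -> is_derive t 1 v b.
Proof. by move=> /funext -> ->. Qed.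

(** The derivative is carried as data, so that identities between pulled-back forms become pointwise
    algebra in [f']. *)
Definition C1_derive f f' :=
  [/\ forall t : R, is_derive t 1 (fun s => Re (f s)) (Re (f' t)),
      forall t : R, is_derive t 1 (fun s => Im (f s)) (Im (f' t)),
      rcont (fun t => Re (f' t)) & rcont (fun t => Im (f' t))].

Lemma is_derive_continuous (u u' : R -> R) :
  (forall t : R, is_derive t 1 u (u' t)) -> rcont u.
Proof.
move=> du; split=> t; apply: differentiable_continuous.
by apply/derivable1_diffP; apply: ex_derive; exact: du.
Qed.

Lemma is_derive_comp (u v : R -> R) (t a b : R) :
  is_derive (v t) 1 u a -> is_derive t 1 v b ->
  is_derive t 1 (fun s => u (v s)) (a * b).
Proof. exact: is_derive1_comp. Qed.

Lemma is_derive_add (u v : R -> R) (t a b : R) :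
  is_derive t 1 u a -> is_derive t 1 v b ->
  is_derive t 1 (fun s => u s + v s) (a + b).
Proof. by move=> du dv; exact: is_deriveD. Qed.

Lemma is_derive_opp (u : R -> R) (t a : R) :
  is_derive t 1 u a -> is_derive t 1 (fun s => - u s) (- a).
Proof. by move=> du; exact: is_deriveN. Qed.

Lemma is_derive_mul (u v : R -> R) (t a b : R) :
  is_derive t 1 u a -> is_derive t 1 v b ->
  is_derive t 1 (fun s => u s * v s) (a * v t + u t * b).
Proof.
move=> du dv; apply: (is_derive_eq (is_deriveM du dv)).
by rewrite /GRing.scale /= addrC [v t * a]mulrC.
Qed.

Lemma is_derive_inv (u : R -> R) (t a : R) : u t != 0 ->
  is_derive t 1 u a -> is_derive t 1 (fun s => (u s)^-1) (- (a / u t ^+ 2)).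
Proof.
move=> u0 du; apply: (is_derive_eq (is_deriveV u0 du)).
by rewrite /GRing.scale /= mulNr mulrC.
Qed.

Lemma rcont_cst (a : R) : rcont (fun=> a).
Proof. by split; exact: cst_continuous. Qed.

Lemma rcont_id : rcont (fun t => t).
Proof. by split=> t; exact: cvg_id. Qed.

Lemma rcont_add (u v : R -> R) :
  rcont u -> rcont v -> rcont (fun s => u s + v s).
Proof. by move=> [cu] [cv]; split=> t; apply: cvgD; [exact: cu|exact: cv]. Qed.

Lemma rcont_opp (u : R -> R) : rcont u -> rcont (fun s => - u s).
Proof. by move=> [cu]; split=> t; apply: cvgN; exact: cu. Qed.

Lemma rcont_mul (u v : R -> R) :
  rcont u -> rcont v -> rcont (fun s => u s * v s).
Proof. by move=> [cu] [cv]; split=> t; apply: cvgM; [exact: cu|exact: cv]. Qed.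

Lemma rcont_inv (u : R -> R) : (forall t, u t != 0) ->
  rcont u -> rcont (fun s => (u s)^-1).
Proof. by move=> u0 [cu]; split=> t; apply: cvgV; [exact: u0|exact: cu]. Qed.

Lemma rcont_comp (u v : R -> R) : rcont u -> rcont v ->
  rcont (fun s => u (v s)).
Proof.
by move=> [cu] [cv]; split=> t; apply: continuous_comp; [exact: cv|exact: cu].
Qed.

Lemma rcont_exp (u : R -> R) n : rcont u -> rcont (fun s => u s ^+ n).
Proof.
move=> cu; elim: n => [|n IH].
  by apply: (rcont_ext _ (rcont_cst 1)) => t; rewrite expr0.
by apply: (rcont_ext _ (rcont_mul cu IH)) => t; rewrite exprS.
Qed.

Lemma ReM (x y : R[i]) : Re (x * y) = Re x * Re y - Im x * Im y.
Proof. by case: x => a b; case: y. Qed.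

Lemma ImM (x y : R[i]) : Im (x * y) = Re x * Im y + Im x * Re y.
Proof. by case: x => a b; case: y. Qed.

Lemma ReD (x y : R[i]) : Re (x + y) = Re x + Re y.
Proof. by case: x => a b; case: y. Qed.

Lemma ImD (x y : R[i]) : Im (x + y) = Im x + Im y.
Proof. by case: x => a b; case: y. Qed.

Lemma ReN (x : R[i]) : Re (- x) = - Re x.
Proof. by case: x. Qed.

Lemma ImN (x : R[i]) : Im (- x) = - Im x.
Proof. by case: x. Qed.

Lemma ReV (x : R[i]) : Re x^-1 = Re x / (Re x ^+ 2 + Im x ^+ 2).
Proof. by case: x. Qed.

Lemma ImV (x : R[i]) : Im x^-1 = - (Im x / (Re x ^+ 2 + Im x ^+ 2)).
Proof. by case: x. Qed.

Lemma sqr_norm_neq0 (x : R[i]) : x != 0 -> Re x ^+ 2 + Im x ^+ 2 != 0.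
Proof.
apply: contraNN; rewrite paddr_eq0 ?sqr_ge0// !sqrf_eq0 => /andP[/eqP a /eqP b].
by rewrite eq_complex a b !eqxx.
Qed.

Lemma complex_ext (x y : R[i]) : Re x = Re y -> Im x = Im y -> x = y.
Proof. by case: x => a b; case: y => c d /= -> ->. Qed.

Definition ccont f := rcont (fun t => Re (f t)) /\ rcont (fun t => Im (f t)).

Lemma ccont_add f g : ccont f -> ccont g -> ccont (fun t => f t + g t).
Proof.
move=> [a b] [a' b']; split.
- by apply: (rcont_ext _ (rcont_add a a')) => t; rewrite ReD.
- by apply: (rcont_ext _ (rcont_add b b')) => t; rewrite ImD.
Qed.

Lemma ccont_opp f : ccont f -> ccont (fun t => - f t).
Proof.
move=> [a b]; split.
- by apply: (rcont_ext _ (rcont_opp a)) => t; rewrite ReN.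
- by apply: (rcont_ext _ (rcont_opp b)) => t; rewrite ImN.
Qed.

Lemma ccont_mul f g : ccont f -> ccont g -> ccont (fun t => f t * g t).
Proof.
move=> [a b] [a' b']; split.
- apply: (rcont_ext _ (rcont_add (rcont_mul a a')
    (rcont_opp (rcont_mul b b')))) => t; by rewrite ReM.
- apply: (rcont_ext _ (rcont_add (rcont_mul a b') (rcont_mul b a'))) => t.
  by rewrite ImM.
Qed.

Lemma ccont_inv f : (forall t, f t != 0) -> ccont f ->
  ccont (fun t => (f t)^-1).
Proof.
move=> f0 [a b].
have cn : rcont (fun t => (Re (f t) ^+ 2 + Im (f t) ^+ 2)^-1).
  apply: rcont_inv; first by move=> t; exact: sqr_norm_neq0.
  exact: rcont_add (rcont_exp 2 a) (rcont_exp 2 b).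
split.
- by apply: (rcont_ext _ (rcont_mul a cn)) => t; rewrite ReV.
- by apply: (rcont_ext _ (rcont_opp (rcont_mul b cn))) => t; rewrite ImV.
Qed.

Lemma C1_derive_continuous f f' : C1_derive f f' ->
  ccont f.
Proof.
by case=> dr di _ _; split; [exact: is_derive_continuous dr|
  exact: is_derive_continuous di].
Qed.

Lemma C1_derive_C1c f f' : C1_derive f f' -> C1c f.
Proof.
case=> dr di [cr] [ci]; split; (split; first by move=> t; apply: ex_derive).
- rewrite (_ : _^`()%classic = (fun t => Re (f' t)))//.
  by apply/funext => t; rewrite derive1E; apply: derive_val.
- rewrite (_ : _^`()%classic = (fun t => Im (f' t)))//.
  by apply/funext => t; rewrite derive1E; apply: derive_val.
Qed.

Lemma C1_derive_derivec f f' t : C1_derive f f' -> derivec f t = f' t.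
Proof.
case=> dr di _ _; rewrite /derivec !derive1E (@derive_val _ _ _ _ _ _ _ (dr t)).
by rewrite (@derive_val _ _ _ _ _ _ _ (di t)); case: (f' t).
Qed.

Lemma C1c_C1_derive f : C1c f -> C1_derive f (derivec f).
Proof.
move=> [[dr cr] [di ci]].
split; [move=> t|move=> t|exact: (RCont cr)|exact: (RCont ci)].
- by have /derivableP := dr t; rewrite -derive1E.
- by have /derivableP := di t; rewrite -derive1E.
Qed.

Lemma C1_derive_cst (c : R[i]) : C1_derive (fun=> c) (fun=> 0).
Proof.
by split; try (move=> t; exact: is_derive_cst); exact: rcont_cst.
Qed.

Lemma C1_derive_eq f f' g' : C1_derive f f' -> (forall t, f' t = g' t) ->
  C1_derive f g'.
Proof. by move=> ff' /funext <-. Qed.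

Lemma C1_derive_ext f g f' : (forall t, f t = g t) -> C1_derive f f' ->
  C1_derive g f'.
Proof. by move=> /funext <-. Qed.

Lemma C1_derive_add f g f' g' : C1_derive f f' -> C1_derive g g' ->
  C1_derive (fun t => f t + g t) (fun t => f' t + g' t).
Proof.
move=> [a b c d] [a' b' c' d']; split.
- by move=> t; apply: (is_derive_ext _ _ (is_derive_add (a t) (a' t))) => *;
    rewrite ReD.
- by move=> t; apply: (is_derive_ext _ _ (is_derive_add (b t) (b' t))) => *;
    rewrite ImD.
- by apply: (rcont_ext _ (rcont_add c c')) => t; rewrite ReD.
- by apply: (rcont_ext _ (rcont_add d d')) => t; rewrite ImD.
Qed.

Lemma C1_derive_mul f g f' g' : C1_derive f f' -> C1_derive g g' ->
  C1_derive (fun t => f t * g t) (fun t => f' t * g t + f t * g' t).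
Proof.
move=> Df Dg; have cf := C1_derive_continuous Df.
have cg := C1_derive_continuous Dg.
case: Df Dg => [a b c d] [a' b' c' d']; split.
- move=> t; apply: (is_derive_ext _ _ (is_derive_add (is_derive_mul (a t) (a' t))
    (is_derive_opp (is_derive_mul (b t) (b' t))))) => [s|].
    by rewrite ReM.
  by rewrite ReD !ReM; ring.
- move=> t; apply: (is_derive_ext _ _ (is_derive_add (is_derive_mul (a t) (b' t))
    (is_derive_mul (b t) (a' t)))) => [s|].
    by rewrite ImM.
  by rewrite ImD !ImM; ring.
- by case: (ccont_add (ccont_mul (conj c d) cg) (ccont_mul cf (conj c' d'))).
- by case: (ccont_add (ccont_mul (conj c d) cg) (ccont_mul cf (conj c' d'))).
Qed.

Lemma C1_derive_inv f f' : (forall t, f t != 0) -> C1_derive f f' ->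
  C1_derive (fun t => (f t)^-1) (fun t => - (f' t / f t ^+ 2)).
Proof.
move=> f0 Df; have cf := C1_derive_continuous Df.
case: Df => [a b c d].
have n0 t : Re (f t) ^+ 2 + Im (f t) ^+ 2 != 0 by exact: sqr_norm_neq0.
have cV := ccont_inv f0 cf.
have cd' := ccont_opp (ccont_mul (conj c d) (ccont_mul cV cV)).
have Dn (t : R) : is_derive t 1 (fun t => (Re (f t) ^+ 2 + Im (f t) ^+ 2)^-1)
   (- ((2 * (Re (f t) * Re (f' t) + Im (f t) * Im (f' t)))
     / (Re (f t) ^+ 2 + Im (f t) ^+ 2) ^+ 2)).
  have h : is_derive t 1 (fun t => Re (f t) ^+ 2 + Im (f t) ^+ 2)
     (2 * (Re (f t) * Re (f' t) + Im (f t) * Im (f' t))).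
    apply: (is_derive_ext _ _ (is_derive_add
      (is_derive_mul (a t) (a t)) (is_derive_mul (b t) (b t)))) => [s|].
      by rewrite !expr2.
    by ring.
  exact: is_derive_inv.
have E t : - (f' t / f t ^+ 2) = - (f' t * ((f t)^-1 * (f t)^-1)).
  by rewrite expr2 invfM.
split.
- move=> t; apply: (is_derive_ext _ _ (is_derive_mul (a t) (Dn t))) => [s|].
    by rewrite ReV.
  rewrite E ReN ReM ReM ImM ReV ImV; have := n0 t.
  by case: (f t) (f' t) => x y [x' y'] /= h; field.
- move=> t; apply: (is_derive_ext _ _ (is_derive_opp (is_derive_mul (b t) (Dn t))))
    => [s|].
    by rewrite ImV.
  rewrite E ImN ImM ReM ImM ReV ImV; have := n0 t.
  by case: (f t) (f' t) => x y [x' y'] /= h; field.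
- by apply: (rcont_ext _ cd'.1) => t; rewrite E.
- by apply: (rcont_ext _ cd'.2) => t; rewrite E.
Qed.

Lemma C1_derive_comp f f' (th th' : R -> R) : C1_derive f f' ->
  (forall t : R, is_derive t 1 th (th' t)) -> rcont th' ->
  C1_derive (fun t => f (th t)) (fun t => f' (th t) * (th' t)%:C).
Proof.
move=> [a b c d] dth cth'; have cth := is_derive_continuous dth.
split.
- by move=> t; rewrite ReM /= mulr0 subr0; exact: is_derive_comp.
- by move=> t; rewrite ImM /= mulr0 add0r; exact: is_derive_comp.
- apply: (rcont_ext _ (rcont_mul (rcont_comp c cth) cth')) => t.
  by rewrite ReM /= mulr0 subr0.
- apply: (rcont_ext _ (rcont_mul (rcont_comp d cth) cth')) => t.
  by rewrite ImM /= mulr0 add0r.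
Qed.

Lemma C1_derive_real (u u' : R -> R) : (forall t : R, is_derive t 1 u (u' t)) ->
  rcont u' -> C1_derive (fun t => (u t)%:C) (fun t => (u' t)%:C).
Proof.
by move=> du cu; split => //=; [move=> t; exact: is_derive_cst|exact: rcont_cst].
Qed.

Lemma C1_derive_unique f f' g' : C1_derive f f' -> C1_derive f g' ->
  forall t, f' t = g' t.
Proof.
by move=> Df Dg t; rewrite -(C1_derive_derivec t Df) (C1_derive_derivec t Dg).
Qed.

Lemma C1_derive0_cst f : C1_derive f (fun=> 0) -> forall s t, f s = f t.
Proof.
case=> a b _ _ s t; apply: complex_ext.
- exact: (is_derive_0_is_cst _ _ a).
- exact: (is_derive_0_is_cst _ _ b).
Qed.

Lemma C1_derive_opp f f' : C1_derive f f' ->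
  C1_derive (fun t => - f t) (fun t => - f' t).
Proof.
move=> Df; apply: (C1_derive_ext (fun t => mulN1r (f t))).
apply: (C1_derive_eq (C1_derive_mul (C1_derive_cst (-1)) Df)) => t.
by rewrite mul0r add0r mulN1r.
Qed.

Lemma C1_derive_scale (c : R[i]) f f' : C1_derive f f' ->
  C1_derive (fun t => c * f t) (fun t => c * f' t).
Proof.
move=> Df; apply: (C1_derive_eq (C1_derive_mul (C1_derive_cst c) Df)) => t.
by rewrite mul0r add0r.
Qed.

Lemma C1_derive_horner (p : {poly R[i]}) f f' : C1_derive f f' ->
  C1_derive (fun t => p.[f t]) (fun t => p^`().[f t] * f' t).
Proof.
move=> Df; elim/poly_ind: p => [|p c IH].
  apply: (C1_derive_ext (fun t => esym (horner0 (f t)))).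
  by apply: (C1_derive_eq (C1_derive_cst 0)) => t; rewrite deriv0 horner0 mul0r.
apply: (C1_derive_ext (f := fun t => p.[f t] * f t + c)).
  by move=> t; rewrite !hornerE.
apply: (C1_derive_eq (C1_derive_add (C1_derive_mul IH Df) (C1_derive_cst c))).
by move=> t; rewrite derivD derivC derivM derivX !hornerE; ring.
Qed.

End ComplexPaths.

Ltac prove_rcont := repeat first [assumption | lazymatch goal with
  | |- rcont (fun t => _ + _) => apply: rcont_add
  | |- rcont (fun t => - _) => apply: rcont_opp
  | |- rcont (fun t => _ * _) => apply: rcont_mul
  | |- rcont (fun t => _ ^+ _) => apply: rcont_exp
  | |- rcont (fun t => ?c) => exact: rcont_cst
  end].

(** * Primitives of continuous functions on the whole line *)

Section Primitives.
Variable R : realType.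

Lemma rcont_norm (u : R -> R) : rcont u -> rcont (fun t => `|u t|).
Proof.
move=> [cu]; split=> t.
by apply: (@continuous_comp _ _ _ u Num.norm); [exact: cu|exact: norm_continuous].
Qed.

Definition pos_part (t : R) : R := (t + `|t|) / 2.

Lemma rcont_pos_part : rcont pos_part.
Proof.
apply: rcont_mul (rcont_cst _); apply: rcont_add (rcont_id R) _.
exact: (rcont_norm (rcont_id R)).
Qed.

Lemma pos_part_le0 t : t <= 0 -> pos_part t = 0.
Proof. by move=> t0; rewrite /pos_part ler0_norm// subrr mul0r. Qed.

Lemma pos_part_ge0 t : 0 <= t -> pos_part t = t.
Proof. by move=> t0; rewrite /pos_part ger0_norm//; field. Qed.

Lemma rcont_integrable (u : R -> R) (a b : R) : rcont u ->
  lebesgue_measure.-integrable `[a, b] (EFin \o u).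
Proof.
move=> [cu]; apply: continuous_compact_integrable; first exact: segment_compact.
exact: continuous_subspaceT.
Qed.

(** The integral from -1 is differentiated by the fundamental theorem for t >= 0; for t < 0 it is
    locally zero because [u] vanishes there. *)
Lemma rcont_primitive_pos (u : R -> R) : rcont u ->
  (forall t, t <= 0 -> u t = 0) ->
  exists U : R -> R, forall t : R, is_derive t 1 U (u t).
Proof.
move=> cu u0; exists (fun t => (\int[lebesgue_measure]_(s in `[(-1), t]) u s)%R).
move=> t; have [t0|t0] := ltP t 0; last first.
  have [||||] := @continuous_FTC1_closed R u (-1) t (t + 1) _ _ _ _.
  - by rewrite ltrDl.
  - exact: rcont_integrable.
  - by rewrite (lt_le_trans _ t0).
  - by case: cu => cu; exact: cu.
  - by move=> dU E; rewrite -E derive1E; apply/derivableP.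
rewrite u0 ?(ltW t0)//.
have d0 : is_derive t 1 (fun=> 0 : R) (0 : R) by exact: is_derive_cst.
apply: near_eq_is_derive d0.
near=> s; rewrite (@eq_Rintegral _ _ _ _ _ (fun=> 0)) ?Rintegral_cst ?mul0r//.
move=> r; rewrite inE/= in_itv/= => /andP[_ rs]; rewrite u0//.
apply: (le_trans rs); apply: ltW; near: s; exact: lt_nbhsl.
Unshelve. all: by end_near. Qed.

(** [u - u 0] splits into a part supported on each half-line; the left one is reflected to the
    one-sided case. *)
Lemma rcont_primitive (u : R -> R) : rcont u ->
  exists U : R -> R, forall t : R, is_derive t 1 U (u t).
Proof.
move=> cu.
have [|t t0|U1 dU1] := @rcont_primitive_pos (fun t => u (pos_part t) - u 0).
- apply: rcont_add (rcont_cst _); exact: rcont_comp rcont_pos_part.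
- by rewrite pos_part_le0// subrr.
have [|t t0|U2 dU2] := @rcont_primitive_pos (fun t => u (- pos_part t) - u 0).
- apply: rcont_add (rcont_cst _); apply: (rcont_comp cu).
  exact: rcont_opp rcont_pos_part.
- by rewrite pos_part_le0// oppr0 subrr.
exists (fun t => U1 t + (- U2 (- t)) + u 0 * t) => t.
have dN : is_derive t 1 (fun s : R => - s) (- 1) by exact: is_deriveN.
have dl : is_derive t 1 (fun s : R => u 0 * s) (0 * t + u 0 * 1).
  by apply: is_derive_mul (is_derive_id _ _); exact: is_derive_cst.
apply: (is_derive_ext _ _ (is_derive_add (is_derive_add (dU1 t)
  (is_derive_opp (is_derive_comp (dU2 _) dN))) dl)) => //.
have [t0|t0] := leP 0 t.
  by rewrite pos_part_ge0// [pos_part (- t)]pos_part_le0 ?oppr_le0// oppr0; ring.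
rewrite pos_part_le0 ?(ltW t0)// pos_part_ge0 ?oppr_ge0 ?(ltW t0)// opprK; ring.
Qed.

Lemma ccont_primitive (u : R -> R[i]) : ccont u ->
  exists U : R -> R[i], C1_derive U u.
Proof.
move=> [cr ci]; have [U dU] := rcont_primitive cr.
by have [V dV] := rcont_primitive ci; exists (fun t => U t +i* V t).
Qed.

Lemma is_derive_MVT (u u' : R -> R) (a b : R) : a < b ->
  (forall t : R, is_derive t 1 u (u' t)) ->
  exists2 c, a < c < b & u b - u a = u' c * (b - a).
Proof.
move=> ab du; have cu : {within `[a, b], continuous u}.
  by apply: continuous_subspaceT; case: (is_derive_continuous du).
have [c] := MVT ab (fun x _ => du x) cu.
by rewrite in_itv/= => h1 h2; exists c.
Qed.

Lemma is_derive_Rintegral (u u' : R -> R) :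
  (forall t : R, is_derive t 1 u (u' t)) -> rcont u' ->
  \int[lebesgue_measure]_(t in `[0, 1]) u' t = u 1 - u 0.
Proof.
move=> du [cu']; have [cu] := is_derive_continuous du.
rewrite /Rintegral (@continuous_FTC2 _ u' u) ?ltr01//.
- exact: continuous_subspaceT.
- split; first by move=> t _; apply: ex_derive.
  + by apply: cvg_at_right_filter; exact: cu.
  + by apply: cvg_at_left_filter; exact: cu.
- by move=> t _; rewrite derive1E; apply: derive_val.
Qed.

Lemma C1_derive_integralc (u u' v : R -> R[i]) : C1_derive u u' ->
  (forall t, t \in `[0, 1] -> v t = u' t) ->
  integralc v = u 1 - u 0.
Proof.
move=> [dr di cr ci] E; apply: complex_ext.
- rewrite ReD ReN -(is_derive_Rintegral dr cr); apply: eq_Rintegral => t.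
  by rewrite inE /= => /E ->.
- rewrite ImD ImN -(is_derive_Rintegral di ci); apply: eq_Rintegral => t.
  by rewrite inE /= => /E ->.
Qed.
End Primitives.

(** * Concatenation and square roots of paths *)

Section FlatPaths.
Variable R : realType.
Implicit Types f g h : R -> R[i].

Lemma C1_derive_cst_itv f f' (a b : R) : a <= b -> C1_derive f f' ->
  (forall t, a < t < b -> f' t = 0) -> f a = f b.
Proof.
rewrite le_eqVlt => /predU1P[->//|ab] [dr di _ _] f0; apply: complex_ext.
- have [c cab /eqP] := is_derive_MVT ab dr.
  by rewrite f0//= mul0r subr_eq0 => /eqP.
- have [c cab /eqP] := is_derive_MVT ab di.
  by rewrite f0//= mul0r subr_eq0 => /eqP.
Qed.

(** Paths at rest outside [0, 1] concatenate to C^1 paths without any smoothing at the junction. *)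
Definition flat f f' := [/\ C1_derive f f',
  forall t, t < 0 -> f' t = 0 & forall t, 1 < t -> f' t = 0].

Lemma flat_le0 f f' t : flat f f' -> t <= 0 -> f t = f 0.
Proof.
move=> [Df f0 _] t0; apply: (C1_derive_cst_itv t0 Df) => s /andP[_].
exact: f0.
Qed.

Lemma flat_ge1 f f' t : flat f f' -> 1 <= t -> f t = f 1.
Proof.
move=> [Df _ f1] t1; apply/esym; apply: (C1_derive_cst_itv t1 Df) => s /andP[].
by move=> /f1.
Qed.

(** A sum instead of a case distinction: for flat paths the increment of [g] vanishes on the first
    half and [f] stays at its endpoint on the second, so the derivative needs no gluing. *)
Definition path_cat f g t := f (2 * t) + (g (2 * t - 1) - g 0).
Definition path_cat' (f' g' : R -> R[i]) t := 2 * f' (2 * t) + 2 * g' (2 * t - 1).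

Lemma flat_path_cat f f' g g' : flat f f' -> flat g g' ->
  flat (path_cat f g) (path_cat' f' g').
Proof.
move=> [Df f0 f1] [Dg g0 g1].
have d1 (t : R) : is_derive t 1 (fun s : R => 2 * s) 2.
  apply: (is_derive_ext _ _
    (is_derive_mul (is_derive_cst (2 : R) t 1) (is_derive_id t 1))) => //.
  by rewrite mul0r add0r mulr1.
have d2 (t : R) : is_derive t 1 (fun s : R => 2 * s - 1) 2.
  apply: (is_derive_ext _ _ (is_derive_add (d1 t)
    (is_derive_cst (-1 : R) t 1))) => //.
  by rewrite addr0.
split.
- apply: C1_derive_eq.
    apply: C1_derive_add (C1_derive_comp Df d1 (rcont_cst _)) _.
    apply: C1_derive_add (C1_derive_comp Dg d2 (rcont_cst _)) _.
    exact: C1_derive_cst.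
  by move=> t; rewrite /path_cat' /= rmorph_nat addr0; ring.
- move=> t t0; rewrite /path_cat' f0 ?g0 ?mulr0 ?addr0//; lra.
- move=> t t1; rewrite /path_cat' f1 ?g1 ?mulr0 ?addr0//; lra.
Qed.

Lemma path_cat_le f f' g g' t : flat f f' -> flat g g' -> t <= 2^-1 ->
  path_cat f g t = f (2 * t).
Proof.
move=> _ Fg t2; rewrite /path_cat (flat_le0 Fg) ?subrr ?addr0//; lra.
Qed.

Lemma path_cat_ge f f' g g' t : flat f f' -> flat g g' -> f 1 = g 0 -> 2^-1 <= t ->
  path_cat f g t = g (2 * t - 1).
Proof.
move=> Ff _ fg t2; rewrite /path_cat (flat_ge1 Ff) ?fg ?[g 0 + _]addrC ?subrK//; lra.
Qed.

Lemma path_cat0 f f' g g' : flat f f' -> flat g g' -> path_cat f g 0 = f 0.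
Proof.
by move=> Ff Fg; rewrite (path_cat_le Ff Fg) ?mulr0// invr_ge0.
Qed.

Lemma path_cat1 f f' g g' : flat f f' -> flat g g' -> f 1 = g 0 ->
  path_cat f g 1 = g 1.
Proof.
move=> Ff Fg fg; rewrite (path_cat_ge Ff Fg)//; last by lra.
by rewrite mulr1 (_ : 2 - 1 = 1 :> R); last ring.
Qed.

Lemma flat_opp f f' : flat f f' -> flat (fun t => - f t) (fun t => - f' t).
Proof.
move=> [Df f0 f1]; split; first exact: C1_derive_opp.
- by move=> t /f0 ->; rewrite oppr0.
- by move=> t /f1 ->; rewrite oppr0.
Qed.

(** [E] is the complex exponential of the path [u]. *)
Lemma cexp_derive (u u' : R -> R[i]) : C1_derive u u' ->
  let E t := (expR (Re (u t)))%:C * (cos (Im (u t)) +i* sin (Im (u t))) in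
  C1_derive E (fun t => u' t * E t).
Proof.
move=> Du; have [cur cui] := C1_derive_continuous Du.
case: Du => [dr di cr ci].
have cexp : rcont (@expR R) by split; exact: continuous_expR.
have ccos : rcont (@cos R) by split; exact: continuous_cos.
have csin : rcont (@sin R) by split; exact: continuous_sin.
have De : C1_derive (fun t => (expR (Re (u t)))%:C)
    (fun t => (expR (Re (u t)) * Re (u' t))%:C).
  exact: (C1_derive_real (fun t => is_derive_comp (is_derive_expR _) (dr t))
    (rcont_mul (rcont_comp cexp cur) cr)).
have Dt : C1_derive (fun t => cos (Im (u t)) +i* sin (Im (u t)))
    (fun t => (- sin (Im (u t)) * Im (u' t)) +i* (cos (Im (u t)) * Im (u' t))).
  split => /=.
  - by move=> t; exact: (is_derive_comp (is_derive_cos _) (di t)).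
  - by move=> t; exact: (is_derive_comp (is_derive_sin _) (di t)).
  - exact: rcont_mul (rcont_opp (rcont_comp csin cui)) ci.
  - exact: rcont_mul (rcont_comp ccos cui) ci.
apply: C1_derive_eq (C1_derive_mul De Dt) _ => t.
case: (u' t) => a b /=; apply: complex_ext;
  rewrite /= ?mul0r ?mulr0 ?subr0 ?add0r ?addr0;
  ring.
Qed.

(** The root is the exponential of a primitive of f' / (2 f), up to a constant factor: the square of
    that exponential divided by f has derivative zero. Its derivative contains the factor f', hence
    flatness is inherited. *)
Lemma sqrt_lift f f' : flat f f' -> (forall t, f t != 0) ->
  exists s s', flat s s' /\ forall t, s t ^+ 2 = f t.
Proof.
move=> [Df f0 f1] fn0.
have cf := C1_derive_continuous Df.
have cf' : ccont f' by case: Df.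
have [psi Dpsi] : exists u, C1_derive u (fun t => f' t * (2 * f t)^-1).
  apply: ccont_primitive; apply: ccont_mul => //.
  apply: ccont_inv; first by move=> t; rewrite mulf_neq0// pnatr_eq0.
  apply: ccont_mul => //; split; exact: rcont_cst.
pose E t : R[i] := (expR (Re (psi t)))%:C * (cos (Im (psi t)) +i* sin (Im (psi t))).
have DE : C1_derive E (fun t => f' t * (2 * f t)^-1 * E t) by exact: cexp_derive.
have E0 t : E t != 0.
  rewrite mulf_neq0//; first by rewrite eq_complex /= gt_eqF ?expR_gt0.
  rewrite eq_complex /=; apply/negP => /andP[/eqP c0 /eqP s0].
  by have := cos2Dsin2 (Im (psi t)); rewrite c0 s0 expr0n addr0 => /esym/eqP;
    rewrite oner_eq0.
have Ec s t : E s * E s * (f s)^-1 = E t * E t * (f t)^-1.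
  apply: (C1_derive0_cst (f := fun t => E t * E t * (f t)^-1)).
  apply: C1_derive_eq
    (C1_derive_mul (C1_derive_mul DE DE) (C1_derive_inv fn0 Df)) _ => r.
  by have := fn0 r; move: (f r) (f' r) (E r) => a b c a0; field.
(* The constant value of E^2 / f; dividing [E] by a root of [k] normalises the lift. *)
pose k := E 0 * E 0 * (f 0)^-1.
have k0 : k != 0 by rewrite mulf_neq0 ?invr_eq0// mulf_neq0.
have r0 : sqrtc k != 0 by rewrite sqrtc_eq0.
exists (fun t => (sqrtc k)^-1 * E t),
   (fun t => (sqrtc k)^-1 * (f' t * (2 * f t)^-1 * E t)); split.
  split; first exact: C1_derive_scale.
  - by move=> t /f0 ->; rewrite !mul0r mulr0.
  - by move=> t /f1 ->; rewrite !mul0r mulr0.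
move=> t; rewrite exprMn exprVn sqr_sqrtc /k (Ec 0 t).
by have := E0 t; have := fn0 t; move: (E t) (f t) => a b ha hb; field; rewrite ha hb.
Qed.

End FlatPaths.

(** * Periods as increments of primitives *)

Section Loops.
Variable R : realType.
Implicit Types (f : {poly R[i]}) (h : R[i] -> R[i]).

(** Reparametrization by [th] makes any C^1 loop flat. It is the normalised primitive of the bump t
    (1 - t) cut off outside [0, 1]. *)
Lemma smooth_step : exists th th' : R -> R,
  [/\ forall t : R, is_derive t 1 th (th' t), rcont th',
      (forall t, t < 0 -> th' t = 0) /\ (forall t, 1 < t -> th' t = 0),
      th 0 = 0 /\ th 1 = 1 & forall t, 0 <= th t <= 1].
Proof.
pose b (t : R) := pos_part t * pos_part (1 - t).
have cb : rcont b.
  apply: rcont_mul (rcont_pos_part R) _; apply: rcont_comp (rcont_pos_part R) _.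
  exact: rcont_add (rcont_cst _) (rcont_opp (rcont_id R)).
have [B dB] := rcont_primitive cb.
have b0 t : t <= 0 -> b t = 0 by move=> t0; rewrite /b pos_part_le0// mul0r.
have b1 t : 1 <= t -> b t = 0.
  by move=> t1; rewrite /b [pos_part (1 - t)]pos_part_le0 ?subr_le0// mulr0.
have bge t : 0 <= b t.
  rewrite /b mulr_ge0// /pos_part.
    by have := ler_norm (- t); rewrite normrN; lra.
  by have := ler_norm (- (1 - t)); rewrite normrN; lra.
have B01 : 0 < B 1 - B 0.
  have [c /andP[c0 c1] ->] := is_derive_MVT (@ltr01 R) dB.
  by rewrite /b !pos_part_ge0 ?subr_ge0 ?ltW// !mulr_gt0// ?subr_gt0// ltr01.
have Bmono s t : s <= t -> B s <= B t.
  rewrite le_eqVlt => /predU1P[->//|st].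
  have [c _ E] := is_derive_MVT st dB.
  by rewrite -subr_ge0 E mulr_ge0// subr_ge0 ltW.
have Bcst (s t : R) : s <= t -> (forall r, s < r < t -> b r = 0) -> B t = B s.
  rewrite le_eqVlt => /predU1P[->//|st] br.
  have [c cst /eqP] := is_derive_MVT st dB.
  by rewrite br// mul0r subr_eq0 => /eqP.
have Bz t : t <= 0 -> B t = B 0.
  move=> t0; apply/esym/Bcst => // r /andP[_ /ltW]; exact: b0.
have Bo t : 1 <= t -> B t = B 1.
  move=> t0; apply/Bcst => // r /andP[/ltW r1 _]; exact: b1.
pose K := (B 1 - B 0)^-1.
have K0 : 0 < K by rewrite invr_gt0.
exists (fun t => K * (B t - B 0)), (fun t => K * b t); split.
- move=> t; apply: (is_derive_ext _ _ (is_derive_mul (is_derive_cst K t 1)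
    (is_derive_add (dB t) (is_derive_cst (- B 0) t 1)))) => //.
  by rewrite mul0r add0r addr0.
- exact: rcont_mul (rcont_cst _) cb.
- split=> t t0; first by rewrite b0 ?mulr0// ltW.
  by rewrite b1 ?mulr0// ltW.
- by split; rewrite ?subrr ?mulr0// /K mulVf// gt_eqF.
- move=> t; have [t0|t0] := leP t 0; first by rewrite Bz// subrr mulr0 lexx ler01.
  have [t1|t1] := leP 1 t.
    by rewrite Bo// /K mulVf ?gt_eqF// ler01 lexx.
  have h1 := Bmono _ _ (ltW t0); have h2 := Bmono _ _ (ltW t1).
  rewrite mulr_ge0 ?subr_ge0 ?(ltW K0)//= -[leRHS](mulVf (lt0r_neq0 B01)) -/K.
  by rewrite ler_pM2l// lerD2r.
Qed.

(** A loop satisfying the curve equation on the whole line, together with a primitive of the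
    pulled-back form; its period is [Phi 1 - Phi 0]. *)
Definition loop_data f h (x x' y Phi : R -> R[i]) :=
  [/\ flat x x', exists y', flat y y',
      C1_derive Phi (fun t => h (x t) / y t * x' t),
      x 0 = x 1 /\ y 0 = y 1 & forall t, y t ^+ 2 = f.[x t] /\ y t != 0].

(** The poles of [h] are allowed at zeros of [f], which loops avoid; for Theta this covers the
    division by l. *)
Definition continuous_off f h := forall z : R -> R[i], ccont z ->
  (forall t, f.[z t] != 0) -> ccont (fun t => h (z t)).

(** The last clause, that no new points are visited, later lets the explicit loop avoid the points
    excluded in [quartic_Theta_period]. *)
Lemma curve_loop_data f h (x y : R -> R[i]) :
  continuous_off f h -> curve_loop f x y ->
  exists X X' Y Phi, [/\ loop_data f h X X' Y Phi,
    integralc (fun t => h (x t) / y t * derivec x t) = Phi 1 - Phi 0 &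
    forall t, exists u, X t = x u].
Proof.
move=> hc [/C1c_C1_derive Dx /C1c_C1_derive Dy x01 y01 xy].
have [th [th' [dth cth' [th0' th1'] [th0 th1] th01]]] := smooth_step.
have cth := is_derive_continuous dth.
(* The clamp onto [0, 1]: the curve equation is known only there, and clamping makes the integrand
   continuous on the whole line. *)
pose c (t : R) := 1 - pos_part (1 - pos_part t).
have cc : rcont c.
  rewrite /c; have cp := rcont_pos_part R.
  apply: rcont_add (rcont_cst _) (rcont_opp _); apply: (rcont_comp cp).
  exact: rcont_add (rcont_cst _) (rcont_opp cp).
have c01 t : c t \in `[0, 1].
  rewrite in_itv /= /c; have [t0|t0] := leP t 0.
    by rewrite (pos_part_le0 t0) subr0 pos_part_ge0// subrr lexx ler01.
  rewrite [pos_part t]pos_part_ge0 ?(ltW t0)//; have [t1|t1] := leP t 1.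
    by rewrite pos_part_ge0 ?subKr ?(ltW t0) ?t1// subr_ge0.
  by rewrite pos_part_le0 ?subr0 ?ler01 ?lexx// subr_le0 ltW.
have cE t : t \in `[0, 1] -> c t = t.
  rewrite in_itv /= => /andP[t0 t1]; rewrite /c [pos_part t]pos_part_ge0//.
  by rewrite pos_part_ge0 ?subr_ge0// subKr.
have comp_c u : ccont u -> ccont (fun t => u (c t)).
  by move=> [cr ci]; split; [exact: rcont_comp cr cc|exact: rcont_comp ci cc].
have cx := comp_c _ (C1_derive_continuous Dx).
have cy := comp_c _ (C1_derive_continuous Dy).
have cx' : ccont (fun t => derivec x (c t)) by apply: comp_c; case: Dx.
have yn0 t : y (c t) != 0 by have [] := xy _ (c01 t).
have [Psi DPsi] : exists u, C1_derive u
    (fun t => h (x (c t)) / y (c t) * derivec x (c t)).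
  apply: ccont_primitive; apply: ccont_mul => //; apply: ccont_mul.
    apply: hc => // t; have [<- _] := xy _ (c01 t).
    by rewrite expf_neq0.
  exact: ccont_inv.
have thI t : th t \in `[0, 1] by rewrite in_itv /= th01.
exists (fun t => x (th t)), (fun t => derivec x (th t) * (th' t)%:C),
  (fun t => y (th t)), (fun t => Psi (th t)); split; last 2 first.
- by rewrite th0 th1; apply: (C1_derive_integralc DPsi) => t tI; rewrite cE.
- by move=> t; exists (th t).
split.
- split; first exact: C1_derive_comp.
  + by move=> t /th0' ->; rewrite mulr0.
  + by move=> t /th1' ->; rewrite mulr0.
- exists (fun t => derivec y (th t) * (th' t)%:C).
  split; first exact: C1_derive_comp.
  + by move=> t /th0' ->; rewrite mulr0.
  + by move=> t /th1' ->; rewrite mulr0.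
- apply: C1_derive_eq (C1_derive_comp DPsi dth cth') _ => t.
  by rewrite cE// mulrA.
- by rewrite th0 th1.
- by move=> t; exact: xy.
Qed.

Lemma period_loop_data f h w : continuous_off f h -> period f h w ->
  exists x x' y Phi, loop_data f h x x' y Phi /\ w = Phi 1 - Phi 0.
Proof.
move=> hc [x [y [xy ->]]].
have [X [X' [Y [Phi [L -> _]]]]] := curve_loop_data hc xy.
by exists X, X', Y, Phi.
Qed.

Lemma period_intro f h (x x' y y' Phi : R -> R[i]) :
  C1_derive x x' -> C1_derive y y' ->
  C1_derive Phi (fun t => h (x t) / y t * x' t) ->
  x 0 = x 1 -> y 0 = y 1 -> (forall t, y t ^+ 2 = f.[x t]) ->
  (forall t, y t != 0) -> period f h (Phi 1 - Phi 0).
Proof.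
move=> Dx Dy DP x01 y01 yx y0; exists x, y; split.
  split=> //; [exact: C1_derive_C1c Dx|exact: C1_derive_C1c Dy].
apply/esym; apply: (C1_derive_integralc DP) => t _.
by rewrite (C1_derive_derivec t Dx).
Qed.

(** After one turn the root of [G] along the loop is multiplied by 1 or -1; continuing with the same
    sign change closes it after two turns, which doubles the period. *)
Lemma loop_data_lift f h x x' y Phi (G : {poly R[i]}) :
  loop_data f h x x' y Phi -> (forall t, G.[x t] != 0) ->
  exists x2 x2' y2 Phi2 s s', [/\ loop_data f h x2 x2' y2 Phi2, flat s s',
    forall t, s t ^+ 2 = G.[x2 t] /\ s t != 0, s 0 = s 1 &
    Phi2 1 - Phi2 0 = 2 * (Phi 1 - Phi 0)].
Proof.
move=> [Fx [y' Fy] DPhi [x01 y01] yx] G0.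
have FG : flat (fun t => G.[x t]) (fun t => G^`().[x t] * x' t).
  case: Fx => Dx f0 f1; split; first exact: C1_derive_horner.
  - by move=> t /f0 ->; rewrite mulr0.
  - by move=> t /f1 ->; rewrite mulr0.
have [s [s' [Fs sG]]] := sqrt_lift FG G0.
have FPhi : flat Phi (fun t => h (x t) / y t * x' t).
  case: Fx => Dx f0 f1; split => //.
  - by move=> t /f0 ->; rewrite mulr0.
  - by move=> t /f1 ->; rewrite mulr0.
(* The root for the second turn: [s] itself if it closed up, its negative otherwise. *)
have [r [r' [Fr rG sr0 sr1]]] : exists r r', [/\ flat r r',
    forall t, r t ^+ 2 = G.[x t], s 1 = r 0 & s 0 = r 1].
  have /eqP : s 0 ^+ 2 = s 1 ^+ 2 by rewrite !sG x01.
  rewrite eqf_sqr => /orP[/eqP s01|/eqP s01].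
    by exists s, s'; split.
  exists (fun t => - s t), (fun t => - s' t); split => //.
  - exact: flat_opp.
  - by move=> t; rewrite sqrrN sG.
  - by rewrite s01 opprK.
exists (path_cat x x), (path_cat' x' x'), (path_cat y y), (path_cat Phi Phi),
  (path_cat s r), (path_cat' s' r').
have half (t : R) : (t <= 2^-1) || (2^-1 <= t).
  by case: (leP t 2^-1) => [//|/ltW ->].
have key t : exists r0, (path_cat x x t = x r0 /\ path_cat y y t = y r0) /\
     (path_cat s r t = s r0 \/ path_cat s r t = r r0).
  case/orP: (half t) => ht.
    exists (2 * t); rewrite (path_cat_le Fx Fx)// (path_cat_le Fy Fy)//.
    by rewrite (path_cat_le Fs Fr)//; split => //; left.
  exists (2 * t - 1); rewrite (path_cat_ge Fx Fx)// (path_cat_ge Fy Fy)//.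
  by rewrite (path_cat_ge Fs Fr)//; split => //; right.
split.
- split.
  + exact: flat_path_cat.
  + by exists (path_cat' y' y'); exact: flat_path_cat.
  + have [DP _ _] := flat_path_cat FPhi FPhi; apply: C1_derive_eq DP _ => t.
    have [_ fx0 fx1] := Fx.
    rewrite /path_cat'; case/orP: (half t) => ht.
      rewrite (path_cat_le Fx Fx)// (path_cat_le Fy Fy)//.
      (* At the junction both halves of the derivative are present, over the same point of the
         curve; away from it one of them is zero. *)
      have [->|tn] := eqVneq t 2^-1.
        rewrite mulfV ?pnatr_eq0// subrr x01 y01.
        by ring.
      rewrite (fx0 (2 * t - 1)); last by rewrite lt_neqAle in tn *; lra.
      by rewrite !mulr0 !addr0; ring.
    rewrite (path_cat_ge Fx Fx)// (path_cat_ge Fy Fy)//.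
    have [->|tn] := eqVneq t 2^-1.
      rewrite mulfV ?pnatr_eq0// subrr x01 y01.
      by ring.
    rewrite (fx1 (2 * t)); last by lra.
    by rewrite !mulr0 !add0r; ring.
  + by rewrite (path_cat0 Fx Fx) (path_cat1 Fx Fx)// (path_cat0 Fy Fy)
      (path_cat1 Fy Fy).
  + by move=> t; have [r0 [[-> ->] _]] := key t; exact: yx.
- exact: flat_path_cat.
- move=> t; have [r0 [[-> _] h1]] := key t.
  have E : path_cat s r t ^+ 2 = G.[x r0] by case: h1 => ->.
  by split => //; rewrite -sqrf_eq0 E.
- by rewrite (path_cat0 Fs Fr) (path_cat1 Fs Fr).
- rewrite /path_cat !mulr1 mulr0 (_ : 2 - 1 = 1 :> R); last by ring.
  rewrite sub0r (flat_ge1 FPhi (t := 2)) ?ler1n// (flat_le0 FPhi (t := -1)).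
    by ring.
  by rewrite oppr_le0.
Qed.

End Loops.

(** * Transfer of periods between curves *)

Section PeriodTransfer.
Variable R : realType.
Implicit Types (f g a b : {poly R[i]}) (h : R[i] -> R[i]).

Lemma continuous_off_horner f g : continuous_off f (fun z => g.[z]).
Proof.
move=> z cz _; elim/poly_ind: g => [|g c IH].
  have -> : (fun t => (0 : {poly R[i]}).[z t]) = fun=> 0.
    by apply/funext => t; rewrite horner0.
  by split; exact: rcont_cst.
have -> : (fun t => (g * 'X + c%:P).[z t]) = fun t => g.[z t] * z t + c.
  by apply/funext => t; rewrite !hornerE.
by apply: ccont_add (ccont_mul IH cz) _; split; exact: rcont_cst.
Qed.

Lemma continuous_off_div a b :
  continuous_off ('X * a) (fun z => b.[z] / z).
Proof.
move=> z cz z0; apply: ccont_mul.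
  exact: (continuous_off_horner b cz z0).
apply: ccont_inv => // t; apply: contraNneq (z0 t) => zt.
by rewrite hornerM hornerX zt mul0r.
Qed.

Lemma two_neq0 : 2 != 0 :> R[i]. Proof. by rewrite pnatr_eq0. Qed.

Lemma sqrt_derive (u u' s s' : R -> R[i]) : C1_derive u u' ->
  C1_derive s s' -> (forall t, s t ^+ 2 = u t) -> (forall t, s t != 0) ->
  forall t, s' t = u' t / (2 * s t).
Proof.
move=> Du Ds su s0 t.
have Ds2 := C1_derive_ext (fun t => esym (expr2 (s t))) (C1_derive_mul Ds Ds).
have := C1_derive_unique (C1_derive_ext su Ds2) Du t => <-.
have := s0 t; have := two_neq0; move: (s t) (s' t).
by move=> x y h2 h; field; rewrite ?h ?h2.
Qed.

(** The form pulls back to 2 g(s) ds / N, and the 2 cancels the doubling of the loop needed for m =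
    sqrt l, so [w] itself is preserved. *)
Lemma Theta_period_quartic a b f g w :
  (forall m, m != 0 -> a.[m ^+ 2] = m ^+ 4 * f.[m - m^-1]) ->
  (forall m, m != 0 -> b.[m ^+ 2] = m ^+ 2 * (m ^+ 2 + 1) * g.[m - m^-1]) ->
  Theta_period a b w -> period f (fun s => g.[s]) w.
Proof.
move=> fa gb /period_loop_data[]; first exact: continuous_off_div.
move=> x [x' [y [Phi [L ->]]]].
have [|x2 [x2' [y2 [Phi2 [m [m' [{}L Fm mx m01]]]]]]] := loop_data_lift (G := 'X) L.
  case: L => _ _ _ _ yx t; have [yt] := yx t.
  apply: contraNneq; rewrite hornerX => xt.
  by rewrite -sqrf_eq0 yt hornerM hornerX xt mul0r.
move=> E; case: L => [[Dx _ _] [y' [Dy _ _]] DPhi [x01 y01] yx].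
have m0 t : m t != 0 by case: (mx t).
have {}mx t : m t ^+ 2 = x2 t by case: (mx t); rewrite hornerX.
case: Fm => [Dm _ _].
have dm := sqrt_derive Dx Dm mx m0.
have DV := C1_derive_inv m0 Dm.
have Ds := C1_derive_add Dm (C1_derive_opp DV).
have D3 := C1_derive_mul (C1_derive_mul DV DV) DV.
have DN := C1_derive_mul Dy D3.
have -> : Phi 1 - Phi 0 = 2^-1 * Phi2 1 - 2^-1 * Phi2 0.
  by rewrite -mulrBr E mulrA mulVf ?two_neq0// mul1r.
have y0 t : y2 t != 0 by case: (yx t).
have N0 t : y2 t * ((m t)^-1 * (m t)^-1 * (m t)^-1) != 0.
  by rewrite !mulf_neq0// invr_eq0.
apply: (period_intro (Phi := fun t => 2^-1 * Phi2 t) Ds DN _ _ _ _ N0).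
- apply: C1_derive_eq (C1_derive_scale 2^-1 DPhi) _ => t.
  rewrite dm -!mx gb//.
  have := y0 t; have := m0 t; have := two_neq0.
  move: (m t) (y2 t) (x2' t) (g.[_]) => M Y X' G h2 M0 Y0.
  by field; rewrite ?M0 ?Y0 ?h2.
- by rewrite m01.
- by rewrite y01 m01.
- move=> t; rewrite exprMn; case: (yx t) => -> _.
  rewrite hornerM hornerX -mx fa//.
  by have := m0 t; move: (m t) (f.[_]) => M F M0; field.
Qed.

(** The way back solves m - 1/m = s through a root of s^2 + 4 = (m + 1/m)^2, whence the points to be
    avoided. The factor 4 is 2 for the doubled loop times 2 from the form. *)
Lemma quartic_Theta_period a b f g x x' y Phi :
  (forall m, m != 0 -> a.[m ^+ 2] = m ^+ 4 * f.[m - m^-1]) ->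
  (forall m, m != 0 -> b.[m ^+ 2] = m ^+ 2 * (m ^+ 2 + 1) * g.[m - m^-1]) ->
  loop_data f (fun s => g.[s]) x x' y Phi -> (forall t, x t ^+ 2 + 4 != 0) ->
  Theta_period a b (4 * (Phi 1 - Phi 0)).
Proof.
move=> fa gb L x4.
have [|x2 [x2' [y2 [Phi2 [d [d' [{}L Fd dx d01]]]]]]] :=
    loop_data_lift (G := 'X^2 + 4%:P) L.
  by move=> t; rewrite hornerD hornerXn hornerC.
move=> E; case: L => [[Dx _ _] [y' [Dy _ _]] DPhi [x01 y01] yx].
have d0 t : d t != 0 by case: (dx t).
have {}dx t : d t ^+ 2 = x2 t * x2 t + 4.
  by case: (dx t); rewrite hornerD hornerXn hornerC expr2.
case: Fd => [Dd _ _].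
have Dx4 := C1_derive_add (C1_derive_mul Dx Dx) (C1_derive_cst 4).
have dd := sqrt_derive Dx4 Dd dx d0.
pose m t := 2^-1 * (x2 t + d t).
have Dm : C1_derive m (fun t => 2^-1 * (x2' t + d' t)).
  exact: C1_derive_scale (C1_derive_add Dx Dd).
have mV t : m t * (2^-1 * (d t - x2 t)) = 1.
  have -> : m t * (2^-1 * (d t - x2 t)) = 4^-1 * (d t ^+ 2 - x2 t * x2 t).
    by rewrite /m; have := two_neq0 => h2; field; rewrite ?pnatr_eq0.
  by rewrite dx addrAC subrr add0r mulVf// pnatr_eq0.
have m0 t : m t != 0.
  by apply/eqP => mt; have := mV t; rewrite mt mul0r => /esym/eqP; rewrite oner_eq0.
have sx t : m t - (m t)^-1 = x2 t.
  have -> : (m t)^-1 = 2^-1 * (d t - x2 t).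
    by apply: (mulfI (m0 t)); rewrite mulfV// mV.
  by rewrite /m; field.
have dm t : d t = m t + (m t)^-1.
  have -> : (m t)^-1 = 2^-1 * (d t - x2 t).
    by apply: (mulfI (m0 t)); rewrite mulfV// mV.
  by rewrite /m; field.
have y0 t : y2 t != 0 by case: (yx t).
have Dl := C1_derive_mul Dm Dm.
have Dn := C1_derive_mul (C1_derive_mul Dl Dm) Dy.
have n0 t : m t * m t * m t * y2 t != 0.
  exact: mulf_neq0 (mulf_neq0 (mulf_neq0 (m0 t) (m0 t)) (m0 t)) (y0 t).
have -> : 4 * (Phi 1 - Phi 0) = 2 * Phi2 1 - 2 * Phi2 0.
  by rewrite -mulrBr E mulrA; congr (_ * _); ring.
have m01 : m 0 = m 1 by rewrite /m x01 d01.
apply: (period_intro (Phi := fun t => 2 * Phi2 t) Dl Dn _ _ _ _ n0).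
- apply: C1_derive_eq (C1_derive_scale 2 DPhi) _ => t.
  rewrite -[m t * m t]expr2 gb// sx dd.
  have e1 : x2' t + (x2' t * x2 t + x2 t * x2' t + 0) / (2 * d t)
     = 2 * (x2' t * m t / d t).
    have := d0 t; have := two_neq0; rewrite /m => h2 h.
    by move: (x2 t) (x2' t) (d t) h => X X' D h; field; rewrite h ?h2.
  rewrite e1 dm.
  have md : m t + (m t)^-1 != 0 by rewrite -dm.
  have md2 : m t ^+ 2 + 1 != 0.
    by have -> : m t ^+ 2 + 1 = m t * (m t + (m t)^-1);
      [have := m0 t; move: (m t) => M M0; field|rewrite mulf_neq0].
  have := y0 t; have := m0 t; have := two_neq0; move: md md2.
  move: (m t) (y2 t) (x2' t) (g.[_]) => M Y X' G md md2 h2 M0 Y0.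
  by field; rewrite ?M0 ?Y0 ?h2 -?expr2 ?md2.
- by rewrite m01.
- by rewrite y01 m01.
- move=> t; rewrite exprMn; case: (yx t) => -> _.
  rewrite hornerM hornerX -[m t * m t]expr2 fa// sx.
  by ring.
Qed.

Lemma period_scale f g h (r s w : R[i]) : r != 0 -> s != 0 ->
  (forall k, g.[k] = f.[r * k] / s ^+ 2) ->
  period f h w -> period g (fun k => h (r * k) * r / s) w.
Proof.
move=> r0 s0 gf [x [y [[Cx Cy x01 y01 xy] ->]]].
have Dx := C1c_C1_derive Cx.
exists (fun t => r^-1 * x t), (fun t => s^-1 * y t); split.
  split.
  - exact: C1_derive_C1c (C1_derive_scale _ Dx).
  - exact: C1_derive_C1c (C1_derive_scale _ (C1c_C1_derive Cy)).
  - by rewrite x01.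
  - by rewrite y01.
  - move=> t /xy[yt y0]; rewrite gf mulVKf// exprMn yt exprVn mulrC.
    by rewrite mulf_neq0// invr_eq0.
congr integralc; apply/funext => t.
rewrite (C1_derive_derivec t (C1_derive_scale r^-1 Dx)) mulVKf//.
have [->|y0] := eqVneq (y t) 0; first by rewrite !(mulr0, invr0, mul0r).
by move: (h _) (derivec x t) (y t) y0 => H X Y y0; field; rewrite r0 s0 y0.
Qed.

(* The 2-isogeny [w = s + sqrt (s ^+ 2 - e1)]. *)
Lemma period_isogeny (e1 e2 b c w : R[i]) : e1 != 0 ->
  period (('X^2 - e1%:P) * ('X^2 - e2%:P))
    (fun s => 2 * b * s ^+ 2 - b * e1 + c) w ->
  period ('X^4 + (2 * e1 - 4 * e2)%:P * 'X^2 + (e1 ^+ 2)%:P)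
    (fun s => b * s ^+ 2 + c) w.
Proof.
move=> e10 /period_loop_data[].
  have := @continuous_off_horner (('X^2 - e1%:P) * ('X^2 - e2%:P))
    ((2 * b)%:P * 'X^2 - (b * e1)%:P + c%:P).
  by congr continuous_off; apply/funext => z; rewrite !hornerE.
move=> x [x' [y [Phi [L ->]]]].
have [|x2 [x2' [y2 [Phi2 [s [s' [{}L Fs sx s01]]]]]]] :=
    loop_data_lift (G := 'X^2 - e1%:P) L.
  case: L => _ _ _ _ yx t; have [yt] := yx t.
  apply: contraNneq => xt.
  by rewrite -sqrf_eq0 yt hornerM xt mul0r.
move=> E; case: L => [[Dx _ _] [y' [Dy _ _]] DPhi [x01 y01] yx].
have s0 t : s t != 0 by case: (sx t).
have {}sx t : s t ^+ 2 = x2 t * x2 t + - e1.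
  by case: (sx t); rewrite !hornerE.
case: Fs => [Ds _ _].
have ds := sqrt_derive (C1_derive_add (C1_derive_mul Dx Dx)
  (C1_derive_cst (- e1))) Ds sx s0.
have y0 t : y2 t != 0 by case: (yx t).
have {}yx t : y2 t ^+ 2 = s t ^+ 2 * (x2 t * x2 t - e2).
  by case: (yx t) => -> _; rewrite !hornerE sx.
have Dw := C1_derive_add Dx Ds.
have DS2 := C1_derive_mul Dy (C1_derive_inv s0 Ds).
have DV := C1_derive_scale 2 (C1_derive_mul Dw DS2).
have S2 t : (y2 t * (s t)^-1) ^+ 2 = x2 t * x2 t + - e2.
  by rewrite exprMn yx exprVn mulrAC mulfV ?mul1r// expf_neq0.
have S20 t : y2 t * (s t)^-1 != 0 by rewrite mulf_neq0 ?invr_eq0.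
have dS2 := sqrt_derive (C1_derive_add (C1_derive_mul Dx Dx)
  (C1_derive_cst (- e2))) DS2 S2 S20.
have w0 t : x2 t + s t != 0.
  apply: contraNneq e10 => w0.
  apply/eqP; have -> : e1 = (x2 t + s t) * (x2 t - s t).
    by rewrite -[e1]opprK -[- e1](addKr (x2 t * x2 t)) -sx; ring.
  by rewrite w0 mul0r.
have V0 t : 2 * ((x2 t + s t) * (y2 t * (s t)^-1)) != 0.
  by rewrite !mulf_neq0 ?two_neq0 ?invr_eq0.
(* Here w^2 = 2 x^2 - e1 + 2 x s with s^2 = x^2 - e1. The cross term contributes the exact form b
   d(y/s), which has no period; the rest is half of the original form, on a doubled loop. *)
have -> : Phi 1 - Phi 0 = (2^-1 * Phi2 1 + b * (y2 1 * (s 1)^-1))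
    - (2^-1 * Phi2 0 + b * (y2 0 * (s 0)^-1)).
  rewrite y01 s01 opprD addrACA subrr addr0 -mulrBr E mulrA.
  by rewrite mulVf ?two_neq0// mul1r.
apply: (period_intro (Phi := fun t => 2^-1 * Phi2 t + b * (y2 t * (s t)^-1))
  Dw DV _ _ _ _ V0).
- apply: C1_derive_eq (C1_derive_add (C1_derive_scale 2^-1 DPhi)
    (C1_derive_scale b DS2)) _ => t.
  rewrite dS2 ds addr0.
  have := y0 t; have := s0 t; have := w0 t; have := sx t; have := two_neq0.
  move: (s t) (y2 t) (x2 t) (x2' t) => S Y X X' h2 SX W0 S0 Y0.
  have -> : e1 = X * X - S ^+ 2 by rewrite SX; ring.
  by field; rewrite ?W0 ?S0 ?Y0 ?h2.
- by rewrite x01 s01.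
- by rewrite x01 y01 s01.
- move=> t; rewrite !hornerD !hornerXn hornerM !hornerC hornerXn.
  have := S2 t; have := sx t; move: (y2 t * (s t)^-1) => S2'.
  move: (s t) (x2 t) => S X h1 h3.
  have -> : (2 * ((X + S) * S2')) ^+ 2 = 4 * (X + S) ^+ 2 * S2' ^+ 2 by ring.
  rewrite h3.
  have -> : e1 = X * X - S ^+ 2 by rewrite h1; ring.
  by ring.
Qed.

End PeriodTransfer.

(** * Linearity and conjugation of periods *)

Section PeriodOperations.
Variable R : realType.
Implicit Types (f : {poly R[i]}) (h : R[i] -> R[i]).

Lemma loop_data_primitive f h1 h2 (x x' y Phi : R -> R[i]) :
  continuous_off f h2 -> loop_data f h1 x x' y Phi ->
  exists Psi, C1_derive Psi (fun t => h2 (x t) / y t * x' t) /\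
    period f h2 (Psi 1 - Psi 0).
Proof.
move=> hc [[Dx _ _] [y' [Dy _ _]] DPhi [x01 y01] yx].
have y0 t : y t != 0 by case: (yx t).
have [Psi DPsi] : exists u, C1_derive u (fun t => h2 (x t) / y t * x' t).
  apply: ccont_primitive; apply: ccont_mul; last by case: Dx.
  apply: ccont_mul; last exact: ccont_inv (C1_derive_continuous Dy).
  apply: hc (C1_derive_continuous Dx) _ => t.
  by case: (yx t) => <- _; rewrite expf_neq0.
exists Psi; split => //.
by apply: (period_intro Dx Dy DPsi) => // t; case: (yx t).
Qed.

Lemma C1_derive_diff (u v u' : R -> R[i]) : C1_derive u u' -> C1_derive v u' ->
  u 1 - u 0 = v 1 - v 0.
Proof.
move=> Du Dv.
have := C1_derive0_cst (C1_derive_eq (C1_derive_add Du (C1_derive_opp Dv))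
  (fun t => subrr _)) 1 0.
by move/eqP; rewrite subr_eq => /eqP ->; ring.
Qed.

Lemma period_add f h1 h2 w : continuous_off f h1 -> continuous_off f h2 ->
  period f (fun z => h1 z + h2 z) w ->
  exists w1 w2, [/\ w = w1 + w2, period f h1 w1 & period f h2 w2].
Proof.
move=> c1 c2 /period_loop_data[].
  by move=> z cz z0; apply: ccont_add; [exact: c1|exact: c2].
move=> x [x' [y [Phi [L ->]]]].
have [P1 [D1 per1]] := loop_data_primitive c1 L.
have [P2 [D2 per2]] := loop_data_primitive c2 L.
exists (P1 1 - P1 0), (P2 1 - P2 0); split => //.
case: L => _ _ DPhi _ _.
rewrite addrACA -opprD; apply: (C1_derive_diff (v := fun t => P1 t + P2 t) DPhi).
by apply: C1_derive_eq (C1_derive_add D1 D2) _ => t; ring.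
Qed.

Lemma period_scal f h (c w : R[i]) : continuous_off f h ->
  period f (fun z => c * h z) w ->
  exists2 w0, w = c * w0 & period f h w0.
Proof.
move=> hc /period_loop_data[].
  move=> z cz z0; apply: ccont_mul; last exact: hc.
  by split; exact: rcont_cst.
move=> x [x' [y [Phi [L ->]]]].
have [P1 [D1 per1]] := loop_data_primitive hc L.
exists (P1 1 - P1 0) => //; case: L => _ _ DPhi _ _.
rewrite mulrBr; apply: (C1_derive_diff (v := fun t => c * P1 t) DPhi).
by apply: C1_derive_eq (C1_derive_scale c D1) _ => t; ring.
Qed.

Lemma C1_derive_conj (u u' : R -> R[i]) : C1_derive u u' ->
  C1_derive (fun t => conjc (u t)) (fun t => conjc (u' t)).
Proof.
move=> [a b c d]; have E (z : R[i]) : Re (conjc z) = Re z /\ Im (conjc z) = - Im z.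
  by case: z.
split.
- by move=> t; apply: (is_derive_ext _ _ (a t)) => *; rewrite (E _).1.
- by move=> t; apply: (is_derive_ext _ _ (is_derive_opp (b t))) => *;
    rewrite (E _).2.
- by apply: (rcont_ext _ c) => t; rewrite (E _).1.
- by apply: (rcont_ext _ (rcont_opp d)) => t; rewrite (E _).2.
Qed.

Lemma period_conj f f' h h' w : continuous_off f h ->
  (forall z, f'.[conjc z] = conjc f.[z]) ->
  (forall z, h' (conjc z) = conjc (h z)) ->
  period f h w -> period f' h' (conjc w).
Proof.
move=> hc ff hh /(period_loop_data hc)[x [x' [y [Phi [L ->]]]]].
case: L => [[Dx _ _] [y' [Dy _ _]] DPhi [x01 y01] yx].
rewrite rmorphB /=; apply: (period_intro (C1_derive_conj Dx) (C1_derive_conj Dy)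
  (Phi := fun t => conjc (Phi t))).
- apply: C1_derive_eq (C1_derive_conj DPhi) _ => t.
  by rewrite !rmorphM /= fmorphV hh.
- by rewrite x01.
- by rewrite y01.
- by move=> t; rewrite ff; case: (yx t) => <- _; rewrite rmorphXn.
- by move=> t; rewrite conjc_eq0; case: (yx t).
Qed.

End PeriodOperations.

(** * An explicit loop on the elliptic curve *)

Section ExplicitLoop.
Variable R : realType.
Variables q l m : R.
Hypotheses (q01 : 0 < q < 1) (l0 : 0 < l) (m0 : 0 < m) (lm : l ^+ 2 = 1 - m ^+ 2).

Let S (t : R) : R := sin (2 * pi * t).
Let C (t : R) : R := cos (2 * pi * t).
(** For alpha = 2 - 4 q^2, [W t] is nu / (1 - kappa^2) at kappa = i tan (pi t). Likewise [n] is nu /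
    (1 + k^2) at the real point k = l / (1 + m), where l and m are the sine and cosine of 2 arctan
    k. The denominator [B] stays positive since m < 1, so the translated axis misses infinity. *)
Let W (t : R) : R := Num.sqrt (1 - (1 - q ^+ 2) * S t ^+ 2).
Let n : R := Num.sqrt (1 - q ^+ 2 * l ^+ 2).
Let B (t : R) : R := 1 + m * C t.

Let S2 t : S t ^+ 2 = 1 - C t ^+ 2.
Proof. by rewrite /S /C sin2cos2. Qed.

Let q2 : 0 < q ^+ 2 < 1.
Proof.
case/andP: q01 => q0 q1.
by rewrite exprn_gt0//= expr_lt1// ltW.
Qed.

Let m1 : m < 1.
Proof.
rewrite -(@expr_lt1 _ 2)// ?ltW//; have := exprn_gt0 2 l0.
by rewrite lm subr_gt0.
Qed.

Let n0 : 0 < n.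
Proof.
rewrite sqrtr_gt0 subr_gt0 lm; case/andP: q2 => a b.
apply: (le_lt_trans _ b); by rewrite ler_piMr ?(ltW a)// gerBl sqr_ge0.
Qed.

Let n2 : n ^+ 2 = 1 - q ^+ 2 * (1 - m ^+ 2).
Proof.
rewrite sqr_sqrtr ?lm//; have := n0; rewrite sqrtr_gt0 lm; exact: ltW.
Qed.

Let C1 t : -1 <= C t <= 1. Proof. by rewrite /C cos_geN1 cos_le1. Qed.

Let W2_ge t : q ^+ 2 <= 1 - (1 - q ^+ 2) * S t ^+ 2.
Proof. by rewrite S2; case/andP: q2 => a b; have := sqr_ge0 (C t); nra. Qed.

Let W2 t : W t ^+ 2 = 1 - (1 - q ^+ 2) * (1 - C t ^+ 2).
Proof.
rewrite sqr_sqrtr ?S2//; have := W2_ge t; case/andP: q2 => a b.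
by rewrite S2; apply: le_trans; exact: ltW.
Qed.

Let W0 t : 0 < W t.
Proof.
rewrite sqrtr_gt0; case/andP: q2 => a b; exact: (lt_le_trans a (W2_ge t)).
Qed.

Let B0 t : 0 < B t.
Proof. by rewrite /B; have := C1 t; have := m0; have := m1; nra. Qed.

Let dlin (t : R) : is_derive t 1 (fun s : R => 2 * pi * s) (2 * pi).
Proof.
apply: (is_derive_ext _ _
    (is_derive_mul (is_derive_cst (2 * pi : R) t 1) (is_derive_id t 1))) => //.
by rewrite mul0r add0r mulr1.
Qed.

Let dS (t : R) : is_derive t 1 S (2 * pi * C t).
Proof.
by apply: (is_derive_ext _ _ (is_derive_comp (is_derive_sin _) (dlin t)));
  rewrite // mulrC.
Qed.

Let dC (t : R) : is_derive t 1 C (- (2 * pi * S t)).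
Proof.
by apply: (is_derive_ext _ _ (is_derive_comp (is_derive_cos _) (dlin t)));
  rewrite // mulrC mulrN.
Qed.

Let dB (t : R) : is_derive t 1 B (- (2 * pi * m * S t)).
Proof.
apply: (is_derive_ext _ _ (is_derive_add (is_derive_cst (1 : R) t 1)
  (is_derive_mul (is_derive_cst m t 1) (dC t)))) => //; rewrite /cst; ring.
Qed.

Let dW (t : R) : is_derive t 1 W (- (2 * pi * (1 - q ^+ 2) * S t * C t / W t)).
Proof.
have h : is_derive t 1 (fun t => 1 - (1 - q ^+ 2) * (S t * S t))
   (- (2 * (2 * pi * (1 - q ^+ 2) * S t * C t))).
  apply: (is_derive_ext _ _ (is_derive_add (is_derive_cst (1 : R) t 1)
    (is_derive_opp (is_derive_mul (is_derive_cst (1 - q ^+ 2) t 1)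
    (is_derive_mul (dS t) (dS t)))))) => //; rewrite /cst; ring.
have w0 : 0 < 1 - (1 - q ^+ 2) * (S t * S t) by have := W0 t; rewrite sqrtr_gt0.
apply: (is_derive_ext _ _ (is_derive_comp
  (v := fun t => 1 - (1 - q ^+ 2) * (S t * S t)) (is_derive1_sqrt w0) h)) => //.
by rewrite -expr2 -/(W t); have := W0 t; move: (W t) => w ww; field; rewrite gt_eqF.
Qed.

Let cS : rcont S := is_derive_continuous dS.
Let cC : rcont C := is_derive_continuous dC.
Let cB : rcont B := is_derive_continuous dB.
Let cW : rcont W := is_derive_continuous dW.

(* In terms of the real point [k = l / (1 + m)] and the coordinate
   [tan (pi * t)] on the imaginary axis, this is translation by [k]. *)
Let kap (t : R) : R[i] := (l * W t / B t) +i* (n * S t / B t).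
Let nu (t : R) : R[i] := (2 * n * W t * (C t + m) / B t ^+ 2) +i*
   (- (2 * l * S t * (m * q ^+ 2 - (1 - q ^+ 2) * C t) / B t ^+ 2)).

Let Bn0 t : B t != 0. Proof. by rewrite gt_eqF. Qed.
Let Wn0 t : W t != 0. Proof. by rewrite gt_eqF. Qed.

Let Dkap : C1_derive kap (fun t => 0 +i* pi * nu t / (W t)%:C).
Proof.
have cV : rcont (fun t => (B t)^-1) by exact: rcont_inv.
have cWV : rcont (fun t => (W t)^-1) by exact: rcont_inv.
apply: (C1_derive_eq (f' := fun t =>
   (2 * pi * l * S t * (m * q ^+ 2 - (1 - q ^+ 2) * C t) * ((B t)^-1 ^+ 2 * (W t)^-1)) +i*
   (2 * pi * n * (C t + m) * (B t)^-1 ^+ 2))).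
  split => /=.
  - move=> t; apply: (is_derive_ext _ _ (is_derive_mul (is_derive_mul
      (is_derive_cst l t 1) (dW t)) (is_derive_inv (Bn0 t) (dB t)))) => //.
    rewrite /cst; have := Bn0 t; have := Wn0 t; have := W2 t; have := S2 t; rewrite /B.
    move: (W t) (S t) (C t) => w s c hs hw w0 b0.
    by field: hs hw; rewrite w0.
  - move=> t; apply: (is_derive_ext _ _ (is_derive_mul (is_derive_mul
      (is_derive_cst n t 1) (dS t)) (is_derive_inv (Bn0 t) (dB t)))) => //.
    rewrite /cst; have := Bn0 t; have := S2 t; rewrite /B.
    move: (S t) (C t) => s c hs b0.
    by field: hs.
  - by prove_rcont.
  - by prove_rcont.
move=> t; apply: complex_ext; rewrite !(ReM, ImM, ReV, ImV) /=;
  have := Bn0 t; have := Wn0 t;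
  move: (W t) (B t) (S t) (C t) => w b s c w0 b0; field; by rewrite ?w0 ?b0.
Qed.

Let Dnu : exists nu', C1_derive nu nu'.
Proof.
have DB := C1_derive_inv _ (C1_derive_real dB (rcont_opp
  (rcont_mul (rcont_cst (2 * pi * m)) cS))).
have {}DB : exists b, C1_derive (fun t => ((B t)%:C)^-1) b.
  exists (fun t => - ((- (2 * pi * m * S t))%:C / (B t)%:C ^+ 2)).
  by apply: DB => t; rewrite eq_complex /= negb_and Bn0.
have {DB} [b Db] := DB.
have cWV : rcont (fun t => (W t)^-1) by exact: rcont_inv.
have DS : exists s, C1_derive (fun t => (S t)%:C) s.
  by eexists; apply: (C1_derive_real dS); prove_rcont.
have DC : exists s, C1_derive (fun t => (C t)%:C) s.
  by eexists; apply: (C1_derive_real dC); prove_rcont.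
have DW : exists s, C1_derive (fun t => (W t)%:C) s.
  by eexists; apply: (C1_derive_real dW); prove_rcont.
case: DS DC DW => [s Ds] [c Dc] [w Dw].
have D1 := C1_derive_add (C1_derive_mul (C1_derive_scale (2 * n)%:C Dw)
    (C1_derive_add Dc (C1_derive_cst m%:C)))
  (C1_derive_mul (C1_derive_scale (0 +i* (- (2 * l))) Ds)
    (C1_derive_add (C1_derive_cst (m * q ^+ 2)%:C)
       (C1_derive_scale (- (1 - q ^+ 2))%:C Dc))).
have D2 := C1_derive_mul D1 (C1_derive_mul Db Db).
eexists; apply: (C1_derive_ext _ D2) => t.
apply: complex_ext; rewrite /nu !(ReM, ImM, ReV, ImV, ReD, ImD) /=;
  have := Bn0 t; move: (W t) (B t) (S t) (C t) => w' b' s' c' b0; by field.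
Qed.

Let curve t : nu t ^+ 2 = kap t ^+ 4 + (2 - 4 * q ^+ 2)%:C * kap t ^+ 2 + 1.
Proof.
have h (a b c d e : R) : e != 0 ->
   4 * (c ^+ 2 - d ^+ 2) = a ^+ 4 - 6 * a ^+ 2 * b ^+ 2 + b ^+ 4
     + (2 - 4 * q ^+ 2) * (a ^+ 2 - b ^+ 2) * e ^+ 2 + e ^+ 4 ->
   8 * (c * d) = 4 * (a * b) * (a ^+ 2 - b ^+ 2)
     + 2 * (2 - 4 * q ^+ 2) * (a * b) * e ^+ 2 ->
   ((2 * c / e ^+ 2) +i* (2 * d / e ^+ 2)) ^+ 2
    = ((a / e) +i* (b / e)) ^+ 4 +
      (2 - 4 * q ^+ 2)%:C * ((a / e) +i* (b / e)) ^+ 2 + 1.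
  move=> e0 h1 h2; apply: complex_ext;
    rewrite !exprS expr0 !(ReM, ImM, ReD, ImD) /=.
    rewrite (_ : _ - _ = 4 * (c ^+ 2 - d ^+ 2) / e ^+ 4); last by field.
    by rewrite h1; field.
  rewrite (_ : _ + _ = 8 * (c * d) / e ^+ 4); last by field.
  by rewrite h2; field.
have -> : nu t = (2 * (n * W t * (C t + m)) / B t ^+ 2) +i*
    (2 * - (l * S t * (m * q ^+ 2 - (1 - q ^+ 2) * C t)) / B t ^+ 2).
  by apply: complex_ext; rewrite /nu /=; ring.
apply: h => //.
- rewrite /B; have := W2 t; have := S2 t; move: (W t) (S t) (C t) => w s c hs hw.
  by ring: lm n2 hs hw.
- rewrite /B; have := W2 t; have := S2 t; move: (W t) (S t) (C t) => w s c hs hw.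
  by ring: lm n2 hs hw.
Qed.

(** The real part vanishes only where C = -m; there S^2 = l^2 and the last factor of the imaginary
    part equals m. *)
Let nu0 t : nu t != 0.
Proof.
have b0 := Bn0 t; have w0 := Wn0 t; have n0' : n != 0 by rewrite gt_eqF.
apply/negP; rewrite eq_complex /= => /andP[h1 h2].
have cm : C t = - m.
  apply/eqP; move: h1; rewrite !mulf_eq0 invr_eq0 expf_eq0 pnatr_eq0.
  by rewrite (negbTE n0') (negbTE w0) (negbTE b0) /= orbF addr_eq0.
have s0 : S t != 0.
  by rewrite -sqrf_eq0 S2 cm sqrrN -lm sqrf_eq0 gt_eqF.
move: h2; rewrite oppr_eq0 !mulf_eq0 invr_eq0 expf_eq0 pnatr_eq0 cm.
rewrite (negbTE s0) (negbTE b0) gt_eqF//= orbF.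
rewrite (_ : _ - _ = m); last by ring.
by rewrite (gt_eqF m0) (gt_eqF l0).
Qed.

Let S0 : S 0 = 0. Proof. by rewrite /S mulr0 sin0. Qed.
Let C0 : C 0 = 1. Proof. by rewrite /C mulr0 cos0. Qed.
Let S1 : S 1 = 0.
Proof. by rewrite /S mulr1 mulr_natl sin2pi. Qed.
Let C1' : C 1 = 1.
Proof. by rewrite /C mulr1 mulr_natl cos2pi. Qed.

Let loop : curve_loop ('X^4 + ((2 - 4 * q ^+ 2)%:C)%:P * 'X^2 + 1) kap nu.
Proof.
have [nu' Dn] := Dnu; split.
- exact: C1_derive_C1c Dkap.
- exact: C1_derive_C1c Dn.
- by rewrite /kap /W /B S0 S1 C0 C1'.
- by rewrite /nu /W /B S0 S1 C0 C1'.
- move=> t _; split => //.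
  by rewrite !hornerD !hornerXn hornerM !hornerC hornerXn curve.
Qed.

(** The holomorphic form is translation invariant, so it pulls back to i pi dt / W as on the
    imaginary axis, and I is the integral of pi / W. The loop is real only at t = 0 and t = 1/2
    modulo 1, at the mutually inverse points k and 1/k. *)
Lemma explicit_loop : exists x y, [/\
  curve_loop ('X^4 + ((2 - 4 * q ^+ 2)%:C)%:P * 'X^2 + 1) x y,
  exists2 I, 0 < I &
    forall c, integralc (fun t => c / y t * derivec x t) = c * (0 +i* I) &
  forall t, Im (x t) = 0 ->
    x t = (l / (1 + m))%:C \/ x t = (l / (1 - m))%:C].
Proof.
exists kap, nu; split; first exact: loop.
- have cWV : rcont (fun t => pi / W t).
    by apply: rcont_mul (rcont_cst _) _; exact: rcont_inv.
  have [P dP] := rcont_primitive cWV.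
  exists (P 1 - P 0).
    have [c _ ->] := is_derive_MVT ltr01 dP.
    by rewrite subr0 mulr1 divr_gt0 ?pi_gt0.
  move=> c.
  have DP : C1_derive (fun t => c * (0 +i* 1) * (P t)%:C)
     (fun t => c * (0 +i* 1) * (pi / W t)%:C).
    exact: C1_derive_scale (C1_derive_real dP cWV).
  rewrite (C1_derive_integralc DP).
    rewrite -mulrBr -mulrA; congr (_ * _).
    by apply: complex_ext; rewrite !(ReM, ImM, ReD, ImD, ReN, ImN) /=; ring.
  move=> t _; rewrite (C1_derive_derivec t Dkap).
  have E : (pi / W t)%:C = pi%:C / (W t)%:C by rewrite fmorph_div.
  rewrite E (_ : 0 +i* pi = (0 +i* 1) * pi%:C); last first.
    by apply: complex_ext; rewrite !(ReM, ImM) /=; ring.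
  have := nu0 t; have : (W t)%:C != 0 by rewrite eq_complex /= negb_and Wn0.
  by move: (nu t) (W t)%:C (0 +i* 1) pi%:C => N w i p w0 N0; field; rewrite w0 N0.
- move=> t /= /eqP; rewrite !mulf_eq0 invr_eq0 (negbTE (Bn0 t)) orbF.
  rewrite (gt_eqF n0)/= => /eqP s0.
  have : C t ^+ 2 = 1 ^+ 2 by have := S2 t; rewrite s0; lra.
  have w1 : W t = 1.
    by rewrite /W s0 expr0n mulr0 subr0 sqrtr1.
  move=> /eqP; rewrite eqf_sqr => /orP[|] /eqP c.
    by left; apply: complex_ext; rewrite /kap /B w1 s0 c /=;
      rewrite ?mulr0 ?mul0r ?mulr1.
  by right; apply: complex_ext; rewrite /kap /B w1 s0 c /=;
    rewrite ?mulr0 ?mul0r ?mulr1 ?mulrN1.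
Qed.

Let G (t : R) : R :=
  S t * (- m + (1 - q ^+ 2) * (m + C t) * (1 + W t)^-1) * (B t)^-1.

(* [G] comes from moving the loop back to the imaginary axis by the addition
   formula and averaging over [k -> k^-1]: adding the exact form [dG] makes the
   integrand of the period of constant sign in [beta_bounds]. *)
Let dG (t : R) : is_derive t 1 G
  (pi * ((l ^+ 2 * W t ^+ 2 - n ^+ 2 * S t ^+ 2) / B t ^+ 2
    - 1 + 2 * (1 - q ^+ 2) / (1 + W t)) / W t).
Proof.
have W1 : 1 + W t != 0 by rewrite gt_eqF// addr_gt0.
have dV := is_derive_inv (u := fun t => 1 + W t) W1
  (is_derive_add (is_derive_cst (1 : R) t 1) (dW t)).
have dK := is_derive_mul (is_derive_mul (is_derive_cst (1 - q ^+ 2) t 1)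
  (is_derive_add (is_derive_cst m t 1) (dC t))) dV.
apply: (is_derive_ext _ _ (is_derive_mul (is_derive_mul (dS t)
  (is_derive_add (is_derive_cst (- m) t 1) dK)) (is_derive_inv (Bn0 t) (dB t))))
  => //.
rewrite /cst /=; have := Bn0 t; have := Wn0 t; move: W1.
have := W2 t; have := S2 t; rewrite /B.
move: (W t) (S t) (C t) => w s c hs hw w1 w0 b0.
by field: lm n2 hs hw; rewrite w0 w1.
Qed.

(** After subtracting dG, the imaginary part of the integrand is pi / W times beta + 1 - 2 (1 - q^2)
    / (1 + W), with integral 0. It is negative if beta <= -1. If beta >= 1 - 2 q, it is nonnegative
    because W >= q and 2 - 2 q = 2 (1 - q^2) / (1 + q), and positive where W > q. *)
Lemma beta_bounds beta : real_periods (2 - 4 * q ^+ 2) beta ->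
  -1 < beta < 1 - 2 * q.
Proof.
move=> per.
pose F t : R[i] := (kap t ^+ 2 + beta%:C) * (0 +i* pi) / (W t)%:C.
have ckap : ccont kap := C1_derive_continuous Dkap.
have ccst (c : R[i]) : ccont (fun=> c) by split; exact: rcont_cst.
have Wc0 t : (W t)%:C != 0 by rewrite eq_complex /= negb_and Wn0.
have cF : ccont F.
  apply: ccont_mul.
    apply: ccont_mul => //; apply: ccont_add => //.
    have -> : (fun t => kap t ^+ 2) = fun t => kap t * kap t.
      by apply/funext => t; rewrite expr2.
    exact: ccont_mul.
  by apply: ccont_inv => //; split => //=; exact: rcont_cst.
have [Phi DPhi] := ccont_primitive cF.
have Phi01 : Im (Phi 1) - Im (Phi 0) = 0.
  rewrite -ImN -ImD; apply: per; exists kap, nu; split; first exact: loop.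
  apply/esym; apply: (C1_derive_integralc DPhi) => t _.
  rewrite (C1_derive_derivec t Dkap) /F.
  have := nu0 t; have := Wc0 t.
  move: (nu t) (W t)%:C (kap t ^+ 2 + _) (0 +i* pi) => N w K i w0 N0.
  by field; rewrite w0 N0.
pose Psi t := Im (Phi t) - G t.
have dPsi (t : R) : is_derive t 1 Psi
    (pi * (beta + 1 - 2 * (1 - q ^+ 2) / (1 + W t)) / W t).
  case: DPhi => _ di _ _.
  apply: (is_derive_ext _ _ (is_derive_add (di t) (is_derive_opp (dG t)))) => //.
  have -> : Im (F t) = pi * (beta + (l ^+ 2 * W t ^+ 2 - n ^+ 2 * S t ^+ 2)
      / B t ^+ 2) / W t.
    rewrite /F /kap expr2 !(ImM, ReM, ImD, ReD, ReV, ImV) /=.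
    have := Wn0 t; have := Bn0 t; move: (W t) (B t) => w b b0 w0.
    by field; rewrite w0 b0.
  have := W0 t; have := Bn0 t; move: (W t) (B t) => w b b0 w0.
  by field; rewrite b0 !gt_eqF// addr_gt0.
have Psi01 : Psi 1 - Psi 0 = 0.
  by rewrite /Psi /G S0 S1 !mul0r !subr0.
have pW t : 0 < pi / W t by rewrite divr_gt0 ?pi_gt0.
have E t : pi * (beta + 1 - 2 * (1 - q ^+ 2) / (1 + W t)) / W t =
   pi / W t * (beta + 1 - 2 * (1 - q ^+ 2) / (1 + W t)) by ring.
case/andP: q01 => q0 q1; case/andP: q2 => _ q21.
apply/andP; split; rewrite ltNge; apply/negP => hb.
  have [c _ /eqP] := is_derive_MVT ltr01 dPsi.
  rewrite Psi01 subr0 mulr1 E eq_sym mulf_eq0 gt_eqF//=.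
  have : 0 < 2 * (1 - q ^+ 2) / (1 + W c).
    by rewrite divr_gt0 ?mulr_gt0 ?subr_gt0// addr_gt0.
  by move=> h /eqP; lra.
have key t : q <= W t -> 2 * (1 - q) * ((W t - q) / (1 + W t)) <=
    beta + 1 - 2 * (1 - q ^+ 2) / (1 + W t).
  move=> qW; apply: (@le_trans _ _ (2 - 2 * q - 2 * (1 - q ^+ 2) / (1 + W t))).
    rewrite le_eqVlt; apply/orP; left; apply/eqP.
    have := W0 t; move: (W t) => w w0; field; by rewrite gt_eqF// addr_gt0.
  by lra.
have qW t : q <= W t.
  apply: (@le_trans _ _ (Num.sqrt (q ^+ 2))).
    by rewrite sqrtr_sqr ger0_norm// ltW.
  exact: ler_wsqrtr (W2_ge t).
have mono (s t : R) : s < t -> Psi s <= Psi t.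
  move=> st; have [c _ e] := is_derive_MVT st dPsi.
  rewrite -subr_ge0 e E mulr_ge0 ?subr_ge0 ?(ltW st)//.
  rewrite mulr_ge0 ?(ltW (pW c))//; apply: le_trans (key _ (qW c)).
  have w1 : 0 <= 1 + W c by rewrite addr_ge0 ?(ltW (W0 c)).
  by rewrite mulr_ge0 ?divr_ge0//; have := qW c; lra.
(* Strictness is needed only on some interval: W = q requires C = 0, and the cosine is positive on
   (0, 1/8). *)
have h8 : 0 < 8^-1 :> R by rewrite invr_gt0.
have [c /andP[c0 c8] e] := is_derive_MVT h8 dPsi.
have Cc : 0 < C c.
  rewrite cos_gt0_pihalf//; have := pi_gt0 R => pi0.
  by rewrite (@lt_trans _ _ 0) ?oppr_lt0 ?divr_gt0 ?mulr_gt0//=; nra.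
have qWc : q < W c.
  rewrite lt_neqAle qW andbT; apply/eqP => qWE.
  have := W2 c; rewrite -qWE; have := exprn_gt0 2 Cc; nra.
have : Psi 0 < Psi 8^-1.
  rewrite -subr_gt0 e subr0 E mulr_gt0// mulr_gt0//.
  apply: lt_le_trans (key _ (qW c)).
  have w1 : 0 < 1 + W c by rewrite addr_gt0.
  by rewrite mulr_gt0 ?divr_gt0//; lra.
have := mono 8^-1 1; rewrite invf_lt1// ltr1n => /(_ isT).
by move: Psi01 => /eqP; rewrite subr_eq0 => /eqP ->; rewrite leNgt => /negP.
Qed.

End ExplicitLoop.

(** * Real palindromic quartics *)

Section PalindromicQuartics.
Variable R : realType.
Implicit Types (a b : {poly R[i]}) (p r : R).

Lemma poly_eq_off0 (K : numFieldType) (a b : {poly K}) :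
  (forall z, z != 0 -> a.[z] = b.[z]) -> a = b.
Proof.
move=> ab; apply/eqP; rewrite -subr_eq0; apply/negPn/negP => d0.
pose s := [seq (i.+1)%:R : K | i <- iota 0 (size (a - b))].
have us : uniq s.
  rewrite map_inj_uniq ?iota_uniq// => i j /eqP.
  by rewrite eqr_nat => /eqP [].
suff rs : all (root (a - b)) s.
  by have := max_poly_roots d0 rs us; rewrite size_map size_iota ltnn.
apply/allP => z /mapP[i _ ->].
by rewrite rootE hornerD hornerN ab ?subrr// pnatr_eq0.
Qed.

(** This is l^2 (x^2 + p x + r) for x = (l - 1)^2 / l, expanded in l so as to match [Wente_poly]. *)
Definition pal_quartic p r : {poly R[i]} :=
  'X^4 - ((4 - p)%:C)%:P * 'X^3 + ((6 - 2 * p + r)%:C)%:P * 'X^2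
  - ((4 - p)%:C)%:P * 'X + 1.

Lemma horner_pal_quartic p r (z : R[i]) : (pal_quartic p r).[z] =
  (z - 1) ^+ 4 + p%:C * z * (z - 1) ^+ 2 + r%:C * z ^+ 2.
Proof.
rewrite /pal_quartic !(hornerD, hornerN, hornerXn, hornerX, hornerC).
rewrite !hornerM !(hornerXn, hornerX, hornerC) /=.
by ring.
Qed.

Lemma size_pal_quartic p r : size (pal_quartic p r) = 5%N.
Proof.
rewrite /pal_quartic -!addrA size_polyDl size_polyXn// ltnS.
apply/leq_sizeP => -[//|[//|[//|[//|j]]]] _.
rewrite !(coefD, coefN, coefCM, coefXn, coefX, coef1) /=.
by rewrite !mulr0 !oppr0 !addr0.
Qed.

Lemma coef_pal_quartic p r i : (pal_quartic p r)`_i =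
  [:: 1; - (4 - p)%:C; (6 - 2 * p + r)%:C; - (4 - p)%:C; 1]`_i.
Proof.
rewrite /pal_quartic !(coefD, coefN, coefCM, coefXn, coefX, coef1).
by case: i => [|[|[|[|[|i]]]]] /=; rewrite ?nth_nil /=; ring.
Qed.

Lemma lead_coef_pal_quartic p r : lead_coef (pal_quartic p r) = 1.
Proof. by rewrite lead_coefE size_pal_quartic coef_pal_quartic. Qed.

Lemma P_R_coef d a : P_R d a -> forall i, (i <= d)%N ->
  a`_i = conjc a`_(d - i).
Proof.
move=> [sa aE] i id; have {}aE l : l != 0 ->
  l ^+ d * conjc a.[(conjc l)^-1] = a.[l] by exact: aE.
pose b := \poly_(j < d.+1) conjc a`_(d - j).
have {1}-> : a = b; last by rewrite coef_poly ltnS id.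
apply: poly_eq_off0 => z z0; rewrite -aE// horner_poly (horner_coef_wide _ sa).
rewrite rmorph_sum /= mulr_sumr (reindex_inj rev_ord_inj) /=.
apply: eq_bigr => j _; rewrite subSS rmorphM rmorphXn /= fmorphV /= conjcK.
have jd : (j <= d)%N by rewrite -ltnS.
have -> : z ^+ d = z ^+ j * z ^+ (d - j) by rewrite -exprD subnKC.
rewrite mulrCA -mulrA exprVn.
by rewrite mulfV ?mulr1// expf_neq0.
Qed.

Lemma P_RP d a : (size a <= d.+1)%N ->
  (forall l, l != 0 -> l ^+ d * conjc a.[(conjc l)^-1] = a.[l]) -> P_R d a.
Proof. by move=> sa aE; split. Qed.

Lemma uniq_rootsP a : a != 0 ->
  (exists s : seq R[i], uniq s /\ a = lead_coef a *: \prod_(z <- s) ('X - z%:P))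
  <-> (forall z, root a z -> a^`().[z] != 0).
Proof.
move=> a0; have l0 : lead_coef a != 0 by rewrite lead_coef_eq0.
split=> [[s [us aE]]|h].
  apply/Pdiv.ClosedField.coprimepP; suff: separable_poly a by rewrite unlock.
  by rewrite aE (eqp_separable (eqp_scale _ l0)) separable_prod_XsubC.
have [s aE] := closed_field_poly_normal a; exists s; split => //.
rewrite -separable_prod_XsubC -(eqp_separable (eqp_scale _ l0)) -aE unlock.
exact/Pdiv.ClosedField.coprimepP.
Qed.
(** The sign [e] is the leading coefficient, real of modulus 1, and real coefficients make [a]
    palindromic. Positivity at l = 1, that is x = 0, gives e r > 0; if p^2 = 4 r then [a] would be
    [e] times a square and have a double root. *)
Lemma H2R_form a : H2R a -> exists e p r, [/\ e = 1 \/ e = -1,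
  a = e%:C *: pal_quartic p r, 0 < e * r & p ^+ 2 != 4 * r].
Proof.
move=> [[aP sa apos [s [us aE]] na] areal].
have cr i : a`_i = (Re a`_i)%:C by apply: complex_ext; rewrite //= areal.
have sym i : (i <= 4)%N -> a`_i = a`_(4 - i).
  by move=> i4; rewrite (P_R_coef aP i4) cr conjc_real -cr.
pose e := Re a`_4.
have e1 : e = 1 \/ e = -1.
  move: na; rewrite lead_coefE sa /= cr -/e normc_def /= expr0n addr0 sqrtr_sqr.
  case=> /eqP; rewrite -[X in _ == X]normr1 eqr_norm2 => /orP[]/eqP; by [left|right].
have ee : e * e = 1 by case: e1 => ->; rewrite ?mulrNN mulr1.
pose p := e * Re a`_3 + 4; pose r := e * Re a`_2 - 6 + 2 * p.
have aQ : a = e%:C *: pal_quartic p r.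
  apply/polyP => i; rewrite coefZ coef_pal_quartic.
  have h : forall x y, e * x = y -> (x%:C = e%:C * y%:C :> R[i]).
    by move=> x y <-; rewrite -rmorphM mulrA ee mul1r.
  case: i => [|[|[|[|[|i]]]]] /=.
  - by rewrite (sym 0%N)// cr mulr1.
  - by rewrite (sym 1%N)// cr -rmorphN; apply: h; rewrite /p; ring.
  - by rewrite cr; apply: h; rewrite /r; ring.
  - by rewrite cr -rmorphN; apply: h; rewrite /p; ring.
  - by rewrite cr mulr1.
  - by rewrite nth_nil mulr0 nth_default// sa.
exists e, p, r; split => //.
  have := apos 1 (normr1 _); rewrite expr1n invr1 mul1r aQ hornerZ.
  rewrite horner_pal_quartic.
  have -> : e%:C * ((1 - 1) ^+ 4 + p%:C * 1 * (1 - 1) ^+ 2 + r%:C * 1 ^+ 2) =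
    (e * r)%:C by rewrite rmorphM /=; ring.
  by rewrite ltcR.
apply/eqP => pr.
have a2 : a = e%:C *: (('X - 1) ^+ 2 + ((p / 2)%:C)%:P * 'X) ^+ 2.
  rewrite aQ; congr (_ *: _); apply: poly_eq_off0 => z _.
  rewrite horner_pal_quartic !(hornerE, horner_exp).
  have -> : r = (p / 2) ^+ 2 by rewrite expr_div_n pr; field.
  have {1}-> : p = p / 2 * 2 by field.
  by rewrite rmorphM /= rmorphXn /=; ring.
have a0 : a != 0 by rewrite -size_poly_gt0 sa.
pose g : {poly R[i]} := ('X - 1) ^+ 2 + ((p / 2)%:C)%:P * 'X.
(* A root of g = X^2 - 2 (1 - p/4) X + 1, hence a common root of [a] and its derivative. *)
pose z : R[i] := (1 - (p / 4)%:C) + sqrtc ((1 - (p / 4)%:C) ^+ 2 - 1).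
have gz : g.[z] = 0.
  rewrite /g hornerD horner_exp hornerM !hornerE.
  have -> : p / 2 = 2 * (p / 4) by field.
  rewrite rmorphM /= rmorph_nat.
  have := sqr_sqrtc ((1 - (p / 4)%:C) ^+ 2 - 1); rewrite /z.
  by move=> h; ring: h.
have /(_ (ex_intro _ s (conj us aE)) z) := (uniq_rootsP a0).1.
rewrite rootE a2 -/g expr2 derivZ derivM !hornerZ hornerM gz hornerD !hornerM gz.
by rewrite !(mulr0, mul0r, addr0) eqxx => /(_ isT).
Qed.


End PalindromicQuartics.

(** * Palindromic quartics and the discriminant of x^2 + p x + r *)

Section ComplexRoots.
Variable R : realType.
Implicit Types (a b : {poly R[i]}) (p r : R).

Lemma quadratic_gt0 p r (x : R) : p ^+ 2 < 4 * r -> 0 < x ^+ 2 + p * x + r.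
Proof.
move=> pr; have -> : x ^+ 2 + p * x + r = (x + p / 2) ^+ 2 + (4 * r - p ^+ 2) / 4.
  by field.
by rewrite ltr_wpDl ?sqr_ge0// divr_gt0// subr_gt0.
Qed.

Lemma quadratic_roots p r : 4 * r < p ^+ 2 ->
  exists e1 e2 : R, [/\ p = - (e1 + e2), r = e1 * e2 & e1 < e2].
Proof.
move=> pr; have d0 : 0 < p ^+ 2 - 4 * r by rewrite subr_gt0.
pose d := Num.sqrt (p ^+ 2 - 4 * r).
have dd : d ^+ 2 = p ^+ 2 - 4 * r by rewrite sqr_sqrtr ?ltW.
have dp : 0 < d by rewrite sqrtr_gt0.
exists ((- p - d) / 2), ((- p + d) / 2); split.
- by field.
- by field: dd.
- lra.
Qed.

Lemma real_poly_conj a (z : R[i]) : real_poly a -> a.[conjc z] = conjc a.[z].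
Proof.
move=> ra; rewrite -horner_map /=; congr horner; apply/polyP => i.
rewrite coef_map /=; have := ra i.
by case: (a`_i) => u v /= ->; apply: complex_ext; rewrite /= ?oppr0.
Qed.

Lemma real_pal_quartic p r : real_poly (pal_quartic p r).
Proof.
by move=> i; rewrite coef_pal_quartic; case: i => [|[|[|[|[|i]]]]] //=;
  rewrite ?nth_nil ?oppr0.
Qed.

(** On the unit circle x = 2 Re l - 2 is real, where the quadratic is positive. At a root z the
    derivative is (2 x + p) (z^2 - 1); its vanishing would make x equal to -p/2, 0 or -4, but x is
    not real. *)
Lemma pal_quartic_H2R p r : p ^+ 2 < 4 * r -> H2R (pal_quartic p r).
Proof.
move=> pr.
have key (z : R[i]) : z != 0 -> (pal_quartic p r).[z] = z ^+ 2 *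
    ((z + z^-1 - 2) ^+ 2 + p%:C * (z + z^-1 - 2) + r%:C).
  by move=> z0; rewrite horner_pal_quartic; field.
have qpos (x : R) : x%:C ^+ 2 + p%:C * x%:C + r%:C != 0 :> R[i].
  rewrite -rmorphXn -rmorphM -!rmorphD eq_complex /= eqxx andbT.
  by rewrite gt_eqF// quadratic_gt0.
split; last exact: real_pal_quartic.
split.
- apply: P_RP; first by rewrite size_pal_quartic.
  move=> l l0; rewrite -real_poly_conj; last exact: real_pal_quartic.
  by rewrite fmorphV /= conjcK !horner_pal_quartic; field.
- exact: size_pal_quartic.
- move=> l l1.
  have l0 : l != 0 by rewrite -normr_gt0 l1.
  have lV : l^-1 = conjc l by rewrite invc_norm l1 expr1n invr1 mul1r.
  rewrite key// mulrA mulVf ?expf_neq0// mul1r lV.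
  have -> : l + conjc l - 2 = (2 * Re l - 2)%:C.
    by case: l {l1 l0 lV} => u v; apply: complex_ext => /=; ring.
  rewrite -rmorphXn -rmorphM -!rmorphD ltcR; exact: quadratic_gt0.
- apply/uniq_rootsP; first by rewrite -size_poly_gt0 size_pal_quartic.
  move=> z; rewrite rootE => z0; apply/negP => dz.
  have zn0 : z != 0.
    apply: contraTneq z0 => ->; rewrite horner_pal_quartic !expr0n /= !mulr0 mul0r.
    by rewrite sub0r !addr0 -signr_odd expr0 oner_eq0.
  pose x := z + z^-1 - 2.
  have qx : x ^+ 2 + p%:C * x + r%:C = 0.
    by move: z0; rewrite key// mulf_eq0 expf_eq0 (negbTE zn0) andbF => /eqP.
  have xr (y : R) : x != y%:C.
    by apply: contraNneq (qpos y) => xy; rewrite -qx xy.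
  have dE : (pal_quartic p r)^`().[z] =
     4 * (z - 1) ^+ 3 + p%:C * (z - 1) ^+ 2 + 2 * p%:C * z * (z - 1)
     + 2 * r%:C * z.
    rewrite /pal_quartic !(derivD, derivN, derivXn, derivX, derivC).
    rewrite !derivM !(derivC, derivXn, derivX).
    rewrite !(hornerD, hornerN, hornerM, hornerC, hornerXn, hornerX, hornerMn) /=.
    by ring.
  have d2 : (pal_quartic p r)^`().[z] = (2 * x + p%:C) * (z ^+ 2 - 1).
    have rE : r%:C = - (x ^+ 2 + p%:C * x).
      by apply/eqP; rewrite -addr_eq0 addrC qx.
    by rewrite dE rE /x; field.
  move: dz; rewrite d2 mulf_eq0 subr_eq0 => /orP[].
    rewrite addr_eq0 => /eqP xp; have := xr (- p / 2); apply/negP/negPn/eqP.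
    by rewrite rmorphM rmorphN fmorphV rmorph_nat /= -xp; field.
  rewrite sqrf_eq1 => /orP[] /eqP z1.
    by have := xr 0; rewrite /x z1 invr1 (_ : 1 + 1 - 2 = 0) ?eqxx//; ring.
  have := xr (- 4); rewrite /x z1 invrN1 (_ : -1 + -1 - 2 = - 4); last by ring.
  by rewrite rmorphN rmorph_nat eqxx.
- by rewrite lead_coef_pal_quartic normr1.
Qed.

(** Were the quadratic to have real roots, x would be real at z. Since Im x = Im z (1 - 1/|z|^2),
    this forces z to be real or of modulus 1. Finally p^2 < 4 r gives r > 0, so e = 1. *)
Lemma quad_roots_pal e p r : e = 1 \/ e = -1 -> 0 < e * r -> p ^+ 2 != 4 * r ->
  quad_roots (e%:C *: pal_quartic p r) -> e = 1 /\ p ^+ 2 < 4 * r.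
Proof.
move=> e1 er pr [z [zi zn _ /= /andP[rz _]]].
have e0 : e%:C != 0 :> R[i].
  by case: e1 => ->; rewrite eq_complex /= negb_and ?oppr_eq0 oner_eq0.
have {}rz : (pal_quartic p r).[z] = 0.
  by move: rz; rewrite rootE hornerZ mulf_eq0 (negbTE e0) => /eqP.
have z0 : z != 0 by apply: contraNneq zi => ->.
suff h : p ^+ 2 < 4 * r.
  split=> //; case: e1 er => // -> er.
  by have := sqr_ge0 p; lra.
rewrite lt_neqAle pr leNgt; apply/negP => /quadratic_roots[f1 [f2 [pE rE _]]].
pose x := z + z^-1 - 2.
have xx : (x - f1%:C) * (x - f2%:C) = 0.
  have -> : (x - f1%:C) * (x - f2%:C) = (pal_quartic p r).[z] / z ^+ 2.
    rewrite horner_pal_quartic pE rE rmorphN rmorphD rmorphM /= /x; by field.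
  by rewrite rz mul0r.
have ix : Im x = 0.
  by move/eqP: xx; rewrite mulf_eq0 !subr_eq0 => /orP[] /eqP ->.
have : Im x = Im z * (1 - (Re z ^+ 2 + Im z ^+ 2)^-1).
  rewrite /x; have := sqr_norm_neq0 z0; case: z {zi zn rz z0 x xx ix} => u v /= h.
  by field.
rewrite ix => /esym/eqP; rewrite mulf_eq0 (negbTE zi) subr_eq0 /= eq_sym invr_eq1.
move=> /eqP n1; move: zn; rewrite normc_def n1 sqrtr1 eqxx //.
Qed.

End ComplexRoots.

(** * The Wente family *)

Section ImaginaryPeriods.
Variable R : realType.
Implicit Types (p r c beta : R).

Definition even_quartic (A B : R[i]) : {poly R[i]} :=
  'X^4 + A%:P * 'X^2 + B%:P.

Lemma horner_even_quartic (A B z : R[i]) :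
  (even_quartic A B).[z] = z ^+ 4 + A * z ^+ 2 + B.
Proof. by rewrite /even_quartic !hornerD !hornerXn hornerM !hornerC hornerXn. Qed.

Lemma horner_quartic_factors (A B z : R[i]) :
  (('X^2 - A%:P) * ('X^2 - B%:P)).[z] = (z ^+ 2 - A) * (z ^+ 2 - B).
Proof. by rewrite hornerM !hornerD !hornerN !hornerXn !hornerC. Qed.

Lemma continuous_off_quad (f : {poly R[i]}) (b c : R[i]) :
  continuous_off f (fun z => b * z ^+ 2 + c).
Proof.
have := continuous_off_horner (f := f) (b%:P * 'X^2 + c%:P).
by congr continuous_off; apply/funext => z; rewrite !hornerD hornerM !hornerC hornerXn.
Qed.

Lemma period_eq (f : {poly R[i]}) (h h' : R[i] -> R[i]) w :
  (forall z, h z = h' z) -> period f h w -> period f h' w.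
Proof. by move=> /funext ->. Qed.

Lemma elliptic_period_imag alpha beta (u : R) w : real_periods alpha beta ->
  period (even_quartic alpha%:C 1)
    (fun k => (0 +i* u) * (1 * k ^+ 2 + beta%:C)) w -> Re w = 0.
Proof.
move=> per /period_scal[]; first exact: continuous_off_quad.
move=> w0 -> pw; rewrite ReM /= mul0r sub0r [Im w0]per ?mulr0 ?oppr0//.
rewrite /elliptic_period; apply: period_eq pw => z; by rewrite mul1r.
Qed.

(** Substitute s = i r^(1/4) k and N = r^(1/2) nu: the form becomes -i r^(1/4) (k^2 + beta) dk /
    nu. *)
Lemma quad_periods_imag p r beta : 0 < r ->
  real_periods (- p / Num.sqrt r) beta -> forall w,
  period (even_quartic p%:C r%:C) (fun s => s ^+ 2 + (- (Num.sqrt r * beta))%:C) w ->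
  Re w = 0.
Proof.
move=> r0 per w.
pose a := Num.sqrt r; pose q := Num.sqrt a.
have a0 : 0 < a by rewrite sqrtr_gt0.
have q0 : 0 < q by rewrite sqrtr_gt0.
have aa : r = a ^+ 2 by rewrite sqr_sqrtr ?ltW.
have qq : a = q ^+ 2 by rewrite sqr_sqrtr ?ltW.
rewrite -/a; have qc : q%:C != 0 :> R[i] by rewrite eq_complex /= eqxx andbT gt_eqF.
have i2 : (0 +i* 1 : R[i]) ^+ 2 = -1 by rewrite sqr_i.
have rho0 : (0 +i* 1) * q%:C != 0 :> R[i].
  by rewrite mulf_neq0// eq_complex /= oner_eq0 andbF.
move=> /(period_scale (g := even_quartic (- p / a)%:C 1) rho0 (s := a%:C)) pw.
apply: (elliptic_period_imag (u := - q) per).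
apply: period_eq (pw _ _) => [z||k].
- have -> : 0 +i* - q = - ((0 +i* 1) * q%:C).
    by apply: complex_ext; rewrite !(ReM, ImM, ReN, ImN) /=; ring.
  rewrite rmorphN rmorphM qq !rmorphXn /=; move: (q%:C) (beta%:C) qc => Q b Q0.
  by field: i2.
- by rewrite eq_complex /= negb_and gt_eqF.
- rewrite !horner_even_quartic rmorphM rmorphN fmorphV aa rmorphXn qq !rmorphXn /=.
  by move: (q%:C) (p%:C) qc => Q P Q0; field: i2.
Qed.

(** Here -m1 and -m2 are the roots in s^2. The rotation s = -i k makes them m1 and m2, the isogeny
    at m2 gives w^4 + (2 m2 - 4 m1) w^2 + m2^2, and w is rescaled by the root of |m2|. The constant
    in the form is the one that becomes beta. *)
Lemma same_sign_periods_imag (m1 m2 beta : R) : m2 != 0 ->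
  real_periods ((2 * m2 - 4 * m1) / `|m2|) beta -> forall w,
  period (even_quartic (m1 + m2)%:C (m1 * m2)%:C)
    (fun s => s ^+ 2 + ((m2 - beta * `|m2|) / 2)%:C) w ->
  Re w = 0.
Proof.
move=> m20 per w.
pose n := `|m2|; pose q := Num.sqrt n.
have n0 : 0 < n by rewrite normr_gt0.
have q0 : 0 < q by rewrite sqrtr_gt0.
have nn : m2 ^+ 2 = n ^+ 2 by rewrite real_normK// num_real.
have qq : n = q ^+ 2 by rewrite sqr_sqrtr ?ltW.
rewrite -/n; have qc : q%:C != 0 :> R[i] by rewrite eq_complex /= eqxx andbT gt_eqF.
pose I : R[i] := 0 +i* 1.
have i2 : I ^+ 2 = -1 by rewrite sqr_i.
have I0 : - I != 0 by rewrite oppr_eq0 eq_complex /= oner_eq0 andbF.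
move=> /(period_scale (g := ('X^2 - (m2%:C)%:P) * ('X^2 - (m1%:C)%:P)) I0
  (oner_neq0 _)) pw.
have {}pw : period (('X^2 - (m2%:C)%:P) * ('X^2 - (m1%:C)%:P))
    (fun s => 2 * (I / 2) * s ^+ 2 - I / 2 * m2%:C + I / 2 * (beta * n)%:C) w.
  apply: period_eq (pw _) => z.
    rewrite rmorphM rmorphB rmorphM fmorphV rmorph_nat /=.
    by move: i2 => i2; field: i2.
  rewrite horner_quartic_factors horner_even_quartic rmorphD rmorphM /=.
  by field: i2.
have {}pw := period_isogeny _ pw.
have {}pw : period (even_quartic (2 * m2 - 4 * m1)%:C (m2 ^+ 2)%:C)
   (fun s => I / 2 * s ^+ 2 + I / 2 * (beta * n)%:C) w.
  rewrite /even_quartic; have -> : (2 * m2 - 4 * m1)%:C =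
    2 * m2%:C - 4 * m1%:C :> R[i] by rewrite rmorphB !rmorphM !rmorph_nat.
  rewrite rmorphXn; apply: pw.
  by rewrite eq_complex /= negb_and m20.
move: pw => /(period_scale (g := even_quartic ((2 * m2 - 4 * m1) / n)%:C 1) qc
  (s := n%:C)) pw.
apply: (elliptic_period_imag (u := q / 2) per).
apply: period_eq (pw _ _) => [z||k].
- have -> : 0 +i* (q / 2) = I * (q%:C / 2).
    rewrite -(rmorph_nat (real_complex R)) -fmorphV -rmorphM /=.
    by apply: complex_ext; rewrite !(ReM, ImM) /=; ring.
  rewrite rmorphM qq !rmorphXn /=; move: (q%:C) (beta%:C) qc => Q b Q0.
  by field.
- by rewrite eq_complex /= negb_and gt_eqF.
- rewrite !horner_even_quartic nn rmorphM fmorphV qq !rmorphXn /=.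
  by move: (q%:C) (_%:C) qc => Q P Q0; field.
Qed.

(* Two isogenies: the first one leads to a quartic with the real roots
   [d ^+ 2 < q ^+ 2] in [s ^+ 2], to which the second one applies. *)
Lemma opposite_sign_periods_imag (q d beta : R) : 0 < q -> d != 0 ->
  let e1 := - (q * d) in let e2 := ((q - d) / 2) ^+ 2 in
  real_periods (2 - 4 * (d / q) ^+ 2) beta -> forall w,
  period (- even_quartic (- (e1 + e2))%:C (e1 * e2)%:C)
    (fun s => s ^+ 2 + (((beta - 1) * q ^+ 2 - 2 * e1) / 4)%:C) w ->
  Re w = 0.
Proof.
move=> q0 d0 e1 e2 per w.
have qc : q%:C != 0 :> R[i] by rewrite eq_complex /= eqxx andbT gt_eqF.
have dc : d%:C != 0 :> R[i] by rewrite eq_complex /= eqxx andbT.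
pose I : R[i] := 0 +i* 1.
have i2 : I ^+ 2 = -1 by rewrite sqr_i.
have I0 : I != 0 by rewrite eq_complex /= oner_eq0 andbF.
pose E1 : R[i] := - (q%:C * d%:C); pose E2 : R[i] := ((q%:C - d%:C) / 2) ^+ 2.
pose B := beta%:C : R[i].
have cE : (((beta - 1) * q ^+ 2 - 2 * e1) / 4)%:C
    = ((B - 1) * q%:C ^+ 2 - 2 * E1) / 4 by rewrite /B /E1 /e1; field.
have e1E : e1%:C = E1 by rewrite /E1 /e1; ring.
have e2E : e2%:C = E2 by rewrite /E2 /e2; field.
have -> : (- (e1 + e2))%:C = - (E1 + E2) by rewrite -e1E -e2E; ring.
have -> : (e1 * e2)%:C = E1 * E2 by rewrite -e1E -e2E; ring.
rewrite cE => /(period_scale (g := ('X^2 - E1%:P) * ('X^2 - E2%:P)) (oner_neq0 _) I0) pw.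
have {}pw : period (('X^2 - E1%:P) * ('X^2 - E2%:P))
    (fun s => 2 * (- I / 2) * s ^+ 2 - (- I / 2) * E1
      + (- I / 4) * ((B - 1) * q%:C ^+ 2)) w.
  apply: period_eq (pw _) => z.
    by field: i2; rewrite I0.
  by rewrite horner_quartic_factors hornerN horner_even_quartic; field: i2.
have E10 : E1 != 0 by rewrite oppr_eq0 mulf_neq0.
have {}pw := period_isogeny E10 pw.
have {}pw : period (('X^2 - (q%:C ^+ 2)%:P) * ('X^2 - (d%:C ^+ 2)%:P))
    (fun s => 2 * (- I / 4) * s ^+ 2 - (- I / 4) * q%:C ^+ 2
      + (- I / 4) * (B * q%:C ^+ 2)) w.
  (* The parametrization by q and d is made for this factorization: 2 e1 - 4 e2 = -(q^2 + d^2) and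
     e1^2 = q^2 d^2. *)
  have -> : ('X^2 - (q%:C ^+ 2)%:P) * ('X^2 - (d%:C ^+ 2)%:P) =
     even_quartic (2 * E1 - 4 * E2) (E1 ^+ 2).
    apply: poly_eq_off0 => z _; rewrite horner_quartic_factors.
    by rewrite horner_even_quartic /E1 /E2; field.
  by apply: period_eq pw => z; field.
have q20 : q%:C ^+ 2 != 0 by rewrite expf_neq0.
have := period_isogeny q20 pw.
move=> /(period_scale (g := even_quartic (2 - 4 * (d / q) ^+ 2)%:C 1) qc q20) {}pw.
apply: (elliptic_period_imag (u := - q / 4) per).
apply: period_eq (pw _) => [z|k].
- have -> : 0 +i* (- q / 4) = - I * (q%:C / 4).
    rewrite -(rmorph_nat (real_complex R)) -fmorphV -rmorphM /=.
    by apply: complex_ext; rewrite !(ReM, ImM, ReN, ImN) /=; ring.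
  by rewrite /B; move: (q%:C) (beta%:C) qc => Q b Q0; field.
- rewrite -/(even_quartic _ _) !horner_even_quartic.
  have -> : (2 - 4 * (d / q) ^+ 2)%:C = 2 - 4 * (d%:C / q%:C) ^+ 2 :> R[i].
    by rewrite -fmorph_div; ring.
  by move: (q%:C) (d%:C) qc => Q D Q0; field.
Qed.

End ImaginaryPeriods.

(** * Every element of the Wente family has the stated form *)

Section WenteToFamily.
Variable R : realType.
Implicit Types (p r c e : R) (a b : {poly R[i]}).

(** For real u and v these are the real-coefficient elements of [P_R 3]: they are palindromic of odd
    formal degree, hence divisible by l + 1. The value at 1 is 2 v. *)
Definition theta_poly (u v : R[i]) : {poly R[i]} :=
  ('X + 1) * (u%:P * ('X - 1) ^+ 2 + v%:P * 'X).

Lemma horner_theta_poly u v z :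
  (theta_poly u v).[z] = (z + 1) * (u * (z - 1) ^+ 2 + v * z).
Proof. by rewrite /theta_poly !hornerE. Qed.

Lemma theta_poly_P_R p r : P_R 3 (theta_poly p%:C r%:C).
Proof.
apply: P_RP.
  rewrite /theta_poly; apply: leq_trans (size_polyMleq _ _) _.
  have s1 : (size ('X + 1 : {poly R[i]})%R <= 2)%N by rewrite -polyC1 size_XaddC.
  have s2 : (size ((p%:C)%:P * ('X - 1) ^+ 2 + (r%:C)%:P * 'X : {poly R[i]})%R <= 3)%N.
    apply: leq_trans (size_polyD _ _) _; rewrite geq_max; apply/andP; split.
      rewrite mul_polyC; apply: leq_trans (size_scale_leq _ _) _.
      by rewrite -polyC1 size_exp_XsubC.
    rewrite mul_polyC; apply: leq_trans (size_scale_leq _ _) _.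
    by rewrite size_polyX.
  by rewrite -subn1 leq_subLR; apply: leq_trans (leq_add s1 s2) _.
move=> l l0; have -> (z : R[i]) : conjc (theta_poly p%:C r%:C).[z] =
    (theta_poly p%:C r%:C).[conjc z].
  rewrite !horner_theta_poly; case: z => x y.
  by apply: complex_ext; rewrite expr2 !(ReM, ImM, ReD, ImD, ReN, ImN) /=; ring.
by rewrite fmorphV /= conjcK !horner_theta_poly; field.
Qed.

Lemma pal_quartic_sqr p r (m : R[i]) : m != 0 ->
  (pal_quartic p r).[m ^+ 2] = m ^+ 4 * (even_quartic p%:C r%:C).[m - m^-1].
Proof.
move=> m0; have : m ^+ 2 - 1 = m * (m - m^-1) by rewrite mulrBr mulfV.
move: (m - m^-1) => s h.
by rewrite [LHS]horner_pal_quartic h [X in _ = _ * X]horner_even_quartic; ring.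
Qed.

Lemma pal_quartic_even_quartic e p r (m : R[i]) : m != 0 ->
  (e%:C *: pal_quartic p r).[m ^+ 2] =
  m ^+ 4 * (e%:C *: even_quartic p%:C r%:C).[m - m^-1].
Proof.
move=> m0; rewrite [LHS]hornerZ [X in _ = _ * X]hornerZ.
by rewrite [X in _ * X = _]pal_quartic_sqr// mulrCA.
Qed.

Lemma theta_poly_B e p r c :
  (forall w, period (e%:C *: even_quartic p%:C r%:C) (fun s => s ^+ 2 + c%:C) w ->
    Re w = 0) ->
  B_ (e%:C *: pal_quartic p r) (theta_poly 1 c%:C).
Proof.
move=> h; split; first exact: theta_poly_P_R.
move=> w /(Theta_period_quartic (g := 'X^2 + (c%:C)%:P)
  (pal_quartic_even_quartic e p r)) pw.
apply: h; apply: period_eq (pw _) => [z|m m0].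
  by rewrite hornerD hornerXn hornerC.
by rewrite horner_theta_poly hornerD hornerXn hornerC; field.
Qed.

Lemma S21_theta_poly a c : S21 a -> B_ a (theta_poly 1 c%:C) -> c = 0.
Proof.
move=> [_ aB] /aB; rewrite horner_theta_poly.
have -> : (1 + 1) * (1 * (1 - 1) ^+ 2 + c%:C * 1) = (2 * c)%:C by ring.
by move=> /complexI/eqP; rewrite mulf_eq0 pnatr_eq0 /= => /eqP.
Qed.

(** The bounds do not mention the translation, so any rational point of the circle l^2 + m^2 = 1
    with positive coordinates serves. *)
Lemma bounds_beta (q beta : R) : 0 < q < 1 ->
  real_periods (2 - 4 * q ^+ 2) beta -> -1 < beta < 1 - 2 * q.
Proof. by move=> q01; apply: (@beta_bounds _ q (3 / 5) (4 / 5)) => //; lra. Qed.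

Section BetaFunction.
Variables (beta : R -> R) (alpha0 : R).
Hypothesis beta_def : is_beta beta.
Hypothesis alpha0_root : unique (fun x => -2 < x < 2 /\ beta x = 0) alpha0.

(** Vanishing would mean that b is the sign of m2, but -1 < b < 1. *)
Lemma same_sign_neq (m1 m2 : R) : 0 < m1 / m2 < 1 -> m2 != 0 ->
  exists2 b, real_periods ((2 * m2 - 4 * m1) / `|m2|) b & m2 - b * `|m2| != 0.
Proof.
move=> /andP[x0 x1] m20; pose x := m1 / m2; rewrite -/x in x0 x1.
have m1E : m1 = x * m2 by rewrite /x divfK.
(* The parameter alpha is 2 - 4 x for m2 > 0 and its negative 2 - 4 (1 - x) for m2 < 0; [y] is q^2
   in either case. *)
pose y := if 0 < m2 then x else 1 - x.
have y01 : 0 < y < 1 by rewrite /y; case: ifP => _; lra.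
have aE : (2 * m2 - 4 * m1) / `|m2| = 2 - 4 * (Num.sqrt y) ^+ 2.
  rewrite sqr_sqrtr; last by case/andP: y01 => /ltW.
  rewrite /y m1E; case: (ltP 0 m2) => m2p.
    by rewrite gtr0_norm//; field.
  by rewrite ler0_norm//; field.
have q01 : 0 < Num.sqrt y < 1.
  case/andP: y01 => y0 y1; rewrite sqrtr_gt0 y0 /=.
  by rewrite -[ltRHS]sqrtr1 ltr_sqrt.
have per : real_periods ((2 * m2 - 4 * m1) / `|m2|)
    (beta ((2 * m2 - 4 * m1) / `|m2|)).
  apply: (beta_def _).1; rewrite aE sqr_sqrtr; last by case/andP: y01 => /ltW.
  by case/andP: y01 => y0 y1; lra.
exists (beta ((2 * m2 - 4 * m1) / `|m2|)) => //.
move: (beta _) per => b per.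
have := bounds_beta q01; rewrite -aE => /(_ _ per)/andP[b1 b2].
case/andP: q01 => q0 _.
case: (ltP 0 m2) => m2p.
  rewrite gtr0_norm// -{1}[m2]mul1r -mulrBl mulf_neq0 ?gt_eqF//; lra.
rewrite ler0_norm// mulrN opprK -{1}[m2]mul1r -mulrDl mulf_neq0// gt_eqF//; lra.
Qed.

(** Vanishing would mean b = 1 - 2 (d/q), exactly the excluded endpoint of the upper bound; b < 1
    would not suffice here. *)
Lemma opposite_sign_neq (q d : R) : 0 < d -> d < q ->
  exists2 b, real_periods (2 - 4 * (d / q) ^+ 2) b &
    (b - 1) * q ^+ 2 - 2 * - (q * d) != 0.
Proof.
move=> d0 dq; have q0 : 0 < q by exact: lt_trans dq.
have x01 : 0 < d / q < 1 by rewrite divr_gt0//= ltr_pdivrMr// mul1r.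
have per : real_periods (2 - 4 * (d / q) ^+ 2) (beta (2 - 4 * (d / q) ^+ 2)).
  apply: (beta_def _).1; case/andP: x01 => x0 x1.
  have : 0 < (d / q) ^+ 2 < 1 by rewrite exprn_gt0//= expr_lt1// ltW.
  by move=> /andP[]; lra.
exists (beta (2 - 4 * (d / q) ^+ 2)) => //.
move: (beta _) per => b /(bounds_beta x01)/andP[_ b2].
have -> : (b - 1) * q ^+ 2 - 2 * - (q * d) = (b - 1 + 2 * (d / q)) * q ^+ 2.
  by field; rewrite gt_eqF.
rewrite mulf_neq0 ?expf_neq0 ?(gt_eqF q0)// lt_eqF//; lra.
Qed.

Lemma Wente_polyE ap : Wente_poly alpha0 ap = pal_quartic (- (alpha0 * ap)) (ap ^+ 2).
Proof.
rewrite /Wente_poly /pal_quartic.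
by rewrite !(opprK, mulrN) [2 * (alpha0 * ap)]mulrA.
Qed.

Lemma abs_div_sqrt_lt2 p r : p ^+ 2 < 4 * r -> -2 < - p / Num.sqrt r < 2.
Proof.
move=> pr; have r0 : 0 < r by have := sqr_ge0 p; lra.
have s0 : 0 < Num.sqrt r by rewrite sqrtr_gt0.
rewrite ltr_pdivlMr// ltr_pdivrMr//.
have : p ^+ 2 < (2 * Num.sqrt r) ^+ 2 by rewrite exprMn sqr_sqrtr ?ltW//; lra.
rewrite -ltr_sqrt ?exprn_gt0 ?mulr_gt0// !sqrtr_sqr [in ltRHS]gtr0_norm ?mulr_gt0//.
by rewrite ltr_norml => /andP[]; lra.
Qed.

Lemma theta_poly_B_quad p r : p ^+ 2 < 4 * r ->
  B_ (pal_quartic p r)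
    (theta_poly 1 (- (Num.sqrt r * beta (- p / Num.sqrt r)))%:C).
Proof.
move=> pr; have r0 : 0 < r by have := sqr_ge0 p; lra.
rewrite -[pal_quartic p r]scale1r; apply: (@theta_poly_B 1) => w.
rewrite scale1r; apply: quad_periods_imag => //.
by apply: (beta_def _).1; exact: abs_div_sqrt_lt2.
Qed.

Lemma Wente_sub_family :
  @Wente R `<=` [set Wente_poly alpha0 alphap | alphap in [set x | 0 < x]].
Proof.
move=> a [Sa ra]; have [e [p [r [e1 aE er pr]]]] := H2R_form (conj Sa.1 ra).
subst a; case: e1 er Sa {ra} => -> er Sa.
- rewrite mul1r in er; have [pr'|pr'] := ltP (p ^+ 2) (4 * r).
    exists (Num.sqrt r) => /=; first by rewrite sqrtr_gt0.
    move: Sa; rewrite scale1r => /S21_theta_poly/(_ (theta_poly_B_quad pr'))/eqP.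
    rewrite oppr_eq0 mulf_eq0 sqrtr_eq0 leNgt er /= => /eqP b0.
    have a0 := alpha0_root.2 _ (conj (abs_div_sqrt_lt2 pr') b0).
    rewrite Wente_polyE a0 divfK ?gt_eqF ?sqrtr_gt0// opprK sqr_sqrtr//.
    exact: ltW.
  have {pr pr'} [x1 [x2 [pE rE x12]]] : exists e1 e2 : R,
      [/\ p = - (e1 + e2), r = e1 * e2 & e1 < e2].
    by apply: quadratic_roots; rewrite lt_neqAle eq_sym pr.
  (* Since r > 0 the roots have the same sign; [m2] is the negative of the root of larger absolute
     value, so which root it is depends on that sign. *)
  suff h m1 m2 : p = m1 + m2 -> r = m1 * m2 -> 0 < m1 / m2 < 1 -> m2 != 0 -> False.
    have [x10|x10] := ltP 0 x1.
      have x20 := lt_trans x10 x12.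
      have := h (- x1) (- x2); case.
      + by rewrite pE opprD.
      + by rewrite mulrNN.
      + by rewrite invrN mulrNN divr_gt0//= ltr_pdivrMr// mul1r.
      + by rewrite oppr_eq0 gt_eqF.
    have x1n : x1 < 0.
      by rewrite lt_neqAle x10 andbT; apply: contraTneq er => x1z;
        rewrite rE x1z mul0r ltxx.
    have x2n : x2 < 0 by move: er; rewrite rE nmulr_rgt0.
    have := h (- x2) (- x1); case.
    + by rewrite pE opprD addrC.
    + by rewrite mulrNN rE mulrC.
    + by rewrite invrN mulrNN nmulr_rgt0// invr_lt0 x1n /= ltr_ndivrMr// mul1r.
    + by rewrite oppr_eq0 lt_eqF.
  move=> pm rm m01 m20; have [b per /negP[]] := same_sign_neq m01 m20.
  suff : (m2 - b * `|m2|) / 2 = 0.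
    by move/eqP; rewrite mulf_eq0 invr_eq0 pnatr_eq0 orbF.
  apply: (S21_theta_poly Sa); apply: theta_poly_B => w.
  by rewrite scale1r pm rm; exact: same_sign_periods_imag.
- have r0 : r < 0 by lra.
  have [x1 [x2 [pE rE x12]]] : exists e1 e2 : R,
      [/\ p = - (e1 + e2), r = e1 * e2 & e1 < e2].
    by apply: quadratic_roots; have := sqr_ge0 p; lra.
  have x1n : x1 < 0.
    by rewrite ltNge; apply/negP => x10; move: r0; rewrite rE; nra.
  have x2p : 0 < x2 by move: r0; rewrite rE nmulr_rlt0.
  (* With q = g1 + g2 and d = g1 - g2 one gets - q d = x1 and ((q - d) / 2)^2 = x2, as the two
     isogenies require. *)
  pose g1 := Num.sqrt (x2 - x1); pose g2 := Num.sqrt x2.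
  have g1E : g1 ^+ 2 = x2 - x1 by rewrite sqr_sqrtr//; lra.
  have g2E : g2 ^+ 2 = x2 by rewrite sqr_sqrtr// ltW.
  have g20 : 0 < g2 by rewrite sqrtr_gt0.
  have g12 : g2 < g1 by rewrite ltr_sqrt; lra.
  have [|| b per /negP[]] := @opposite_sign_neq (g1 + g2) (g1 - g2); [lra|lra|].
  suff : ((b - 1) * (g1 + g2) ^+ 2 - 2 * - ((g1 + g2) * (g1 - g2))) / 4 = 0.
    by move/eqP; rewrite mulf_eq0 invr_eq0 pnatr_eq0 orbF.
  apply: (S21_theta_poly Sa); apply: theta_poly_B => w.
  have -> : ((-1)%:C : R[i]) = -1 by rewrite rmorphN1.
  rewrite scaleN1r => pw.
  apply: (opposite_sign_periods_imag _ _ per).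
  + lra.
  + by rewrite gt_eqF//; lra.
  have e1E : - ((g1 + g2) * (g1 - g2)) = x1 by ring: g1E g2E.
  have e2E : ((g1 + g2 - (g1 - g2)) / 2) ^+ 2 = x2 by rewrite -g2E; field.
  by rewrite e2E e1E -pE -rE -{1}e1E.
Qed.

End BetaFunction.
End WenteToFamily.

(** * Every polynomial of the stated form lies in the Wente family *)

Section FamilyToWente.
Variable R : realType.
Implicit Types (p r c e u v : R) (a b : {poly R[i]}).

Lemma B_add a b1 b2 : B_ a b1 -> B_ a b2 -> B_ a (b1 + b2).
Proof.
move=> [[s1 P1] h1] [[s2 P2] h2]; split.
  split; first by apply: leq_trans (size_polyD _ _) _; rewrite geq_max s1.
  by move=> l l0; rewrite !hornerD rmorphD mulrDr P1// P2.
move=> w; rewrite /Theta_period => pw.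
have [] := @period_add _ ('X * a) (fun l => b1.[l] / l) (fun l => b2.[l] / l) w.
- exact: continuous_off_div.
- exact: continuous_off_div.
- by apply: period_eq pw => z; rewrite hornerD mulrDl.
by move=> w1 [w2 [-> /h1 r1 /h2 r2]]; rewrite ReD r1 r2 addr0.
Qed.

Lemma B_scale a b c : B_ a b -> B_ a (c%:C *: b).
Proof.
move=> [[s1 P1] h1]; split.
  split; first exact: leq_trans (size_scale_leq _ _) _.
  move=> l l0; rewrite !hornerZ rmorphM mulrCA P1//; congr (_ * _).
  exact: conjc_real.
move=> w; rewrite /Theta_period => pw.
have [] := @period_scal _ ('X * a) (fun l => b.[l] / l) c%:C w.
- exact: continuous_off_div.
- by apply: period_eq pw => z; rewrite hornerZ mulrA.
by move=> w0 -> /h1 r1; rewrite ReM /= r1 mulr0 mul0r subr0.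
Qed.

Lemma horner_map_conjc b (z : R[i]) :
  (map_poly conjc b).[z] = conjc b.[conjc z].
Proof. by rewrite -[z in LHS]conjcK horner_map. Qed.

(** Conjugation maps the curve of a real [a] to itself and conjugates periods, which keeps their
    real parts. *)
Lemma B_conj a b : real_poly a -> B_ a b -> B_ a (map_poly conjc b).
Proof.
move=> ra [[s1 P1] h1]; split.
  apply: P_RP; first by rewrite size_map_poly.
  move=> l l0; rewrite !horner_map_conjc conjcK fmorphV /= conjcK.
  have /(congr1 conjc) : conjc l ^+ 3 * conjc b.[(conjc (conjc l))^-1]
      = b.[conjc l] by apply: P1; rewrite conjc_eq0.
  by rewrite rmorphM rmorphXn /= !conjcK.
move=> w pw; rewrite -[w]conjcK; have -> (z : R[i]) : Re (conjc z) = Re z.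
  by case: z.
apply: h1; apply: period_conj pw; first exact: continuous_off_div.
- by move=> z; rewrite !hornerM !hornerX rmorphM /= real_poly_conj.
- by move=> z; rewrite horner_map_conjc rmorphM fmorphV /= conjcK.
Qed.

(** The squares of the two real points of the explicit loop are 1/4 and 4 for (4/5, 3/5), and 1/9
    and 9 for (3/5, 4/5); [A] misses one of these pairs. *)
Lemma choose_modulus (A : R) : exists l m : R, [/\ 0 < l /\ 0 < m,
  l ^+ 2 = 1 - m ^+ 2, (l / (1 + m)) ^+ 2 != A & (l / (1 - m)) ^+ 2 != A].
Proof.
have [/orP h|] := boolP ((A == 9^-1) || (A == 9)).
  exists (4 / 5), (3 / 5); split; [by split; lra|by field| |].
  - rewrite (_ : _ ^+ 2 = 4^-1); last by field.
    by apply/eqP; case: h => /eqP ->; lra.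
  - rewrite (_ : _ ^+ 2 = 4); last by field.
    by apply/eqP; case: h => /eqP ->; lra.
rewrite negb_or => /andP[h1 h2]; exists (3 / 5), (4 / 5).
split; [by split; lra|by field| |].
- by rewrite (_ : _ ^+ 2 = 9^-1); [rewrite eq_sym|field].
- by rewrite (_ : _ ^+ 2 = 9); [rewrite eq_sym|field].
Qed.

Lemma curve_loop_scale (f g : {poly R[i]}) (x y : R -> R[i]) (r s : R[i]) :
  s != 0 -> (forall k, g.[r * k] = s ^+ 2 * f.[k]) -> curve_loop f x y ->
  curve_loop g (fun t => r * x t) (fun t => s * y t).
Proof.
move=> s0 gf [Cx Cy x01 y01 xy]; split.
- exact: C1_derive_C1c (C1_derive_scale r (C1c_C1_derive Cx)).
- exact: C1_derive_C1c (C1_derive_scale s (C1c_C1_derive Cy)).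
- by rewrite x01.
- by rewrite y01.
- by move=> t /xy[yt y0]; rewrite gf exprMn yt mulf_neq0.
Qed.

(** The explicit loop has period i J for dk / nu, and s = i r^(1/4) k supplies another i: the
    resulting period of Theta is real, a nonzero multiple of v. *)
Lemma holomorphic_notin_B p r v : p ^+ 2 < 4 * r ->
  B_ (pal_quartic p r) (theta_poly 0 v%:C) -> v = 0.
Proof.
move=> pr [_ hB]; have r0 : 0 < r by have := sqr_ge0 p; lra.
pose a := Num.sqrt r; pose s := Num.sqrt a.
have a0 : 0 < a by rewrite sqrtr_gt0.
have s0 : 0 < s by rewrite sqrtr_gt0.
have aa : r = a ^+ 2 by rewrite sqr_sqrtr ?ltW.
have ss : a = s ^+ 2 by rewrite sqr_sqrtr ?ltW.
have ac : a%:C != 0 :> R[i] by rewrite eq_complex /= eqxx andbT gt_eqF.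
have sc : s%:C != 0 :> R[i] by rewrite eq_complex /= eqxx andbT gt_eqF.
pose I : R[i] := 0 +i* 1.
have i2 : I ^+ 2 = -1 by rewrite sqr_i.
have /andP[al1 al2] := abs_div_sqrt_lt2 pr; rewrite -/a in al1 al2.
pose q := Num.sqrt ((2 + p / a) / 4).
have q2 : q ^+ 2 = (2 + p / a) / 4 by rewrite sqr_sqrtr//; lra.
have q01 : 0 < q < 1.
  by rewrite sqrtr_gt0 -[X in _ && (_ < X)]sqrtr1 ltr_sqrt//; lra.
have [l [m [[l0 m0] lm lmA lmB]]] := choose_modulus (4 / a).
have [x [y [xy [J J0 xyJ] xreal]]] := explicit_loop q01 l0 m0 lm.
pose X t := I * s%:C * x t; pose Y t := a%:C * y t.
have XY : curve_loop (even_quartic p%:C r%:C) X Y.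
  apply: curve_loop_scale xy => // k.
  have -> : 2 - 4 * q ^+ 2 = - p / a by rewrite q2; field; rewrite gt_eqF.
  rewrite [LHS]horner_even_quartic [X in _ = _ * X](horner_even_quartic _ 1).
  rewrite rmorphM rmorphN fmorphV aa rmorphXn /= ss !rmorphXn /=.
  by move: (s%:C) (p%:C) sc => S P S0; field: i2.
have [X1 [X1' [Y1 [Phi [L intE X1X]]]]] :=
  curve_loop_data (continuous_off_horner (v%:C)%:P) XY.
have E : integralc (fun t => (v%:C)%:P.[X t] / Y t * derivec X t) =
    v%:C * (I * s%:C) / a%:C * (0 +i* J).
  rewrite -xyJ; congr integralc; apply/funext => t.
  case: xy => /C1c_C1_derive Dx _ _ _ _.
  rewrite hornerC (C1_derive_derivec t (C1_derive_scale (I * s%:C) Dx)) /Y invfM.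
  by move: (y t)^-1 => z; ring.
have /hB : Theta_period (pal_quartic p r) (theta_poly 0 v%:C) (4 * (Phi 1 - Phi 0)).
  apply: quartic_Theta_period L _.
  - exact: pal_quartic_sqr.
  - by move=> k k0; rewrite horner_theta_poly hornerC mul0r add0r; ring.
  (* X^2 = -4 means x^2 = 4/a, a positive real. Then x is real, hence one of the two real points of
     the loop, both excluded by the choice of l and m. *)
  - move=> t; have [t' ->] := X1X t; apply/eqP => xt.
    have x2 : x t' ^+ 2 = (4 / a)%:C.
      have h4 : s%:C ^+ 2 * x t' ^+ 2 = 4.
        apply/eqP; rewrite eq_sym -subr_eq0 -xt /X; apply/eqP; ring: i2.
      rewrite fmorph_div rmorph_nat ss rmorphXn /= -h4 mulrC mulKf//.
      by rewrite expf_neq0.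
    have a40 : 0 < 4 / a by rewrite divr_gt0.
    have xi : Im (x t') = 0.
      move: x2; case: (x t') => u w x2.
      have := congr1 (@complex.Re R) x2; have := congr1 (@complex.Im R) x2.
      rewrite expr2 /= => /eqP h1 h2; apply/eqP.
      have : u * w = 0 by move/eqP: h1; lra.
      move/eqP; rewrite mulf_eq0 => /orP[/eqP u0|//].
      by move: h2; rewrite u0; nra.
    case: (xreal t' xi) => xE; move: x2; rewrite xE -rmorphXn => /complexI/eqP.
    + by rewrite (negbTE lmA).
    + by rewrite (negbTE lmB).
rewrite -intE E.
have -> : 4 * (v%:C * (I * s%:C) / a%:C * (0 +i* J)) = (- (4 * v * s / a * J))%:C.
  have -> : 0 +i* J = I * J%:C.
    by apply: complex_ext; rewrite !(ReM, ImM) /=; ring.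
  have -> : (- (4 * v * s / a * J))%:C = - (4 * v%:C * s%:C / a%:C * J%:C).
    by rewrite -fmorphV; ring.
  by field: i2.
rewrite /= => /eqP; rewrite oppr_eq0 !mulf_eq0 invr_eq0 pnatr_eq0.
by rewrite (gt_eqF J0) (gt_eqF a0) (gt_eqF s0) /= !orbF => /eqP.
Qed.

Section BetaFunction.
Variables (beta : R -> R) (alpha0 : R).
Hypothesis beta_def : is_beta beta.
Hypothesis alpha0_root : unique (fun x => -2 < x < 2 /\ beta x = 0) alpha0.

(** Since beta vanishes at alpha0, [theta_poly 1 0] lies in B_a; removing its multiple from b + conj
    b leaves [theta_poly 0 v], so v = 0. The reality condition at l = 1 makes b(1) real, so the
    value 2 v of b + conj b at 1 is 2 b(1). *)
Lemma pal_quartic_S21 p r : p ^+ 2 < 4 * r -> - p / Num.sqrt r = alpha0 ->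
  S21 (pal_quartic p r).
Proof.
move=> pr al; have [Ha ra] := pal_quartic_H2R pr; split=> // b Bb.
pose b' := b + map_poly conjc b.
have Bb' : B_ (pal_quartic p r) b' by apply: B_add => //; exact: B_conj.
have rb' i : b'`_i = (2 * Re b`_i)%:C.
  rewrite coefD coef_map /=; case: (b`_i) => x y.
  by apply: complex_ext => /=; ring.
(* Read off from [theta_poly u v], whose two lowest coefficients are u and v - u. *)
pose u := 2 * Re b`_0; pose v := u + 2 * Re b`_1.
have b'E : b' = theta_poly u%:C v%:C.
  have [[sb _] _] := Bb'.
  have sym := P_R_coef Bb'.1.
  apply: poly_eq_off0 => z _; rewrite (horner_coef_wide _ sb) horner_theta_poly.
  rewrite !big_ord_recl big_ord0 /= (sym 2%N)// (sym 3%N)// !rb' !conjc_real.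
  by rewrite -/u /v; ring.
have B0 := theta_poly_B_quad beta_def pr.
rewrite al (alpha0_root.1).2 mulr0 oppr0 in B0.
have Bv : B_ (pal_quartic p r) (theta_poly 0 v%:C).
  have -> : theta_poly 0 v%:C = b' + (- u)%:C *: theta_poly 1 0%:C.
    apply: poly_eq_off0 => z _.
    by rewrite hornerD hornerZ b'E !horner_theta_poly; ring.
  by apply: B_add => //; exact: B_scale.
have v0 := holomorphic_notin_B pr Bv.
have b1 : b.[1] = conjc b.[1].
  have [[_ P] _] := Bb; have := P 1 (oner_neq0 _).
  by rewrite expr1n mul1r rmorph1 invr1.
have : b'.[1] = 0 by rewrite b'E v0 horner_theta_poly subrr; ring.
rewrite hornerD horner_map_conjc rmorph1 -b1 -mulr2n => /eqP.
by rewrite mulrn_eq0 => /eqP.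
Qed.

Lemma family_sub_Wente :
  [set Wente_poly alpha0 alphap | alphap in [set x | 0 < x]] `<=` @Wente R.
Proof.
have [[/andP[al1 al2] _] _] := alpha0_root.
move=> _ [ap /= ap0 <-]; rewrite Wente_polyE.
have pr : (- (alpha0 * ap)) ^+ 2 < 4 * ap ^+ 2.
  rewrite sqrrN exprMn ltr_pM2r ?exprn_gt0//; nra.
split; last exact: real_pal_quartic.
apply: pal_quartic_S21 => //.
by rewrite opprK sqrtr_sqr gtr0_norm// mulfK// gt_eqF.
Qed.

Lemma WenteE :
  @Wente R = [set Wente_poly alpha0 alphap | alphap in [set x | 0 < x]].
Proof.
apply/seteqP; split; last exact: family_sub_Wente.
exact: (Wente_sub_family beta_def alpha0_root).
Qed.

End BetaFunction.
End FamilyToWente.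

(** * Topology of the Wente family *)

Section Topology.
Variable R : realType.
Implicit Types (p r t : R) (a b : {poly R[i]}).

Lemma is_derive_scale_vec (V : normedModType R) (u : R -> R) (v : V) (t a : R) :
  is_derive t 1 u a -> is_derive t 1 (fun s => u s *: v) (a *: v).
Proof.
move=> [du <-].
have c : (fun h => h^-1 *: (((fun s => u s *: v) \o shift t) (h *: (1 : R))
    - u t *: v)) @ 0^' --> 'D_1 u t *: v.
  rewrite (_ : (fun h => _) = (fun h => (h^-1 *: ((u \o shift t) (h *: (1 : R))
      - u t)) *: v)).
    by apply: cvgZr_tmp; exact: du.
  by apply/funext => h /=; rewrite -scalerBl scalerA.
split; first by apply/cvg_ex; exists ('D_1 u t *: v).
by apply/cvg_lim => //.
Qed.

Definition quad_vec1 : 'rV[R]_5 :=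
  \row_(i < 5) [:: 0; 1; -2; 1; 0]`_i.
Definition quad_vec2 : 'rV[R]_5 :=
  \row_(i < 5) [:: 0; 0; 1; 0; 0]`_i.

Lemma coefv_pal_quartic p r : coefv (pal_quartic p r) =
  coefv (pal_quartic 0 0) + p *: quad_vec1 + r *: quad_vec2.
Proof.
apply/rowP => -[i i5]; rewrite !mxE !coef_pal_quartic /=.
by case: i i5 => [|[|[|[|[|i]]]]] //= _; ring.
Qed.

Lemma coefv_inj a b : H2R a -> H2R b -> coefv a = coefv b -> a = b.
Proof.
move=> [[_ sa _ _ _] ra] [[_ sb _ _ _] rb] /rowP ab; apply/polyP => i.
have [i5|i5] := ltnP i 5; last by rewrite !nth_default ?sa ?sb.
apply: complex_ext; last by rewrite ra rb.
by have := ab (Ordinal i5); rewrite !mxE.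
Qed.

Lemma quad_roots_form a : H2R a -> quad_roots a ->
  exists p r, p ^+ 2 < 4 * r /\ a = pal_quartic p r.
Proof.
move=> Ha; have [e [p [r [e1 aE er pr]]]] := H2R_form Ha; rewrite aE.
move=> /(quad_roots_pal e1 er pr)[-> pr']; exists p, r; split=> //.
by rewrite scale1r.
Qed.

Lemma continuous_vec (V : normedModType R) (u w : R -> R) (v0 v1 v2 : V) :
  rcont u -> rcont w -> continuous (fun t => v0 + u t *: v1 + w t *: v2).
Proof.
move=> [cu] [cw] t; apply: cvgD; last by apply: cvgZr_tmp; exact: cw.
by apply: cvgD; [exact: cvg_cst|apply: cvgZr_tmp; exact: cu].
Qed.

Lemma pal_quartic_component p1 r1 p2 r2 (a : {poly R[i]}) :
  p1 ^+ 2 < 4 * r1 -> p2 ^+ 2 < 4 * r2 ->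
  connected_component (@coefv R @` @H2R R) (coefv a) (coefv (pal_quartic p1 r1)) ->
  connected_component (@coefv R @` @H2R R) (coefv a) (coefv (pal_quartic p2 r2)).
Proof.
move=> pr1 pr2 /connected_component_trans; apply.
pose g t := coefv (pal_quartic (p1 + t * (p2 - p1)) (r1 + t * (r2 - r1))).
have gE : g = fun t => coefv (pal_quartic 0 0) + (p1 + t * (p2 - p1)) *: quad_vec1
    + (r1 + t * (r2 - r1)) *: quad_vec2.
  by apply/funext => t; rewrite /g coefv_pal_quartic.
have cg : continuous g.
  by rewrite gE; apply: continuous_vec;
    apply: rcont_add (rcont_cst _) (rcont_mul (rcont_id R) (rcont_cst _)).
apply: (@connected_component_max _ _ (g @` `[0, 1])).
- by exists 0; rewrite /= ?in_itv /= ?lexx ?ler01// /g !mul0r !addr0.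
- move=> _ [t /= tI <-]; move: tI; rewrite in_itv /= => /andP[t0 t1].
  exists (pal_quartic (p1 + t * (p2 - p1)) (r1 + t * (r2 - r1))) => //.
  apply: pal_quartic_H2R.
  (* Concavity of 4 r - p^2: along the segment it equals the interpolated value plus t (1 - t) (p2 -
     p1)^2. *)
  have := sqr_ge0 (p2 - p1) => h.
  have : 0 <= t * (1 - t) * (p2 - p1) ^+ 2.
    by rewrite mulr_ge0// mulr_ge0// subr_ge0.
  have : 0 < t * (4 * r2 - p2 ^+ 2) + (1 - t) * (4 * r1 - p1 ^+ 2).
    have [->|tn0] := eqVneq t 0; first by rewrite mul0r add0r subr0 mul1r subr_gt0.
    have tp : 0 < t by rewrite lt_neqAle eq_sym tn0.
    apply: ltr_pwDl; first by rewrite mulr_gt0// subr_gt0.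
    by rewrite mulr_ge0// subr_ge0// ltW.
  nra.
- apply: connected_continuous_connected; last exact: continuous_subspaceT.
  by apply/connected_intervalP; exact: interval_is_interval.
- exists 1; rewrite /= ?in_itv /= ?lexx ?ler01// /g !mul1r.
  by rewrite ![_ + (_ - _)]addrC !subrK.
Qed.

(** The component is nonempty and its elements have four non-real roots off the unit circle, so it
    contains some [pal_quartic p1 r1] with p1^2 < 4 r1; a segment joins this one to any other. *)
Lemma A_minus_pal_quartic A p r : is_A_minus A -> p ^+ 2 < 4 * r ->
  A (pal_quartic p r).
Proof.
move=> [AH [a0 Ha0 AE] Aq] pr.
have : (@coefv R @` A) (coefv a0).
  by rewrite AE; apply: connected_component_refl; exists a0.
move=> [a1 Aa1 a01].
have [p1 [r1 [pr1 a1E]]] := quad_roots_form (AH _ Aa1) (Aq _ Aa1).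
have : (@coefv R @` A) (coefv (pal_quartic p r)).
  rewrite AE; apply: (pal_quartic_component pr1 pr); rewrite -a1E -AE.
  by exists a1.
move=> [a2 Aa2 /coefv_inj <-//]; [exact: AH|exact: pal_quartic_H2R].
Qed.

(** * The family as a connected, non-compact, embedded curve *)

Section Curve.
Variable alpha0 : R.
Hypothesis alpha0_bounds : 0 < alpha0 < 2.

Let family : set {poly R[i]} :=
  [set Wente_poly alpha0 alphap | alphap in [set x | 0 < x]].

(** The exponential turns the parameter half-line into all of R, the domain that [submanifold1] asks
    for. *)
Let Wcurve t := coefv (Wente_poly alpha0 (expR t)).

Let WcurveE t : Wcurve t = coefv (pal_quartic 0 0) +
  expR t *: (- alpha0 *: quad_vec1) + expR (2 * t) *: quad_vec2.
Proof.
rewrite /Wcurve Wente_polyE coefv_pal_quartic scalerA.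
rewrite mulrN [expR t * _]mulrC; congr (_ + _ *: _).
by rewrite expr2 -expRD; congr expR; ring.
Qed.

Let WcurveP : range Wcurve = @coefv R @` family.
Proof.
apply/seteqP; split.
  by move=> _ [t _ <-]; exists (Wente_poly alpha0 (expR t)) => //;
    exists (expR t) => //=; exact: expR_gt0.
move=> _ [_ [x /= x0 <-] <-]; exists (ln x) => //.
by rewrite /Wcurve lnK.
Qed.

(** Recovers alpha_+ from the coefficient -(4 + alpha0 alpha_+) of l. As a continuous left inverse
    on the whole space it yields both the embedding and the failure of compactness, its image of the
    family being the unbounded half-line. *)
Let height (v : 'rV[R]_5) : R := (- 4 - v 0 1) / alpha0.

Let heightE x : height (coefv (Wente_poly alpha0 x)) = x.
Proof.
have a0 : alpha0 != 0 by case/andP: alpha0_bounds => a _; rewrite gt_eqF.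
rewrite /height Wente_polyE !mxE coef_pal_quartic /=; by field.
Qed.

Let height_continuous : continuous height.
Proof.
have c1 : continuous (fun v : 'rV[R]_5 => v 0 1) by exact: coord_continuous.
move=> v; apply: (@continuous_comp _ _ _ (fun v : 'rV[R]_5 => v 0 1)
  (fun x => (- 4 - x) / alpha0)); first exact: c1.
have [h] : rcont (fun x => (- 4 - x) / alpha0); last exact: h.
apply: rcont_mul (rcont_cst _).
exact: rcont_add (rcont_cst _) (rcont_opp (rcont_id R)).
Qed.

Lemma family_connected : connected (@coefv R @` family).
Proof.
rewrite -WcurveP; apply: connected_continuous_connected.
  by apply/connected_intervalP.
apply: continuous_subspaceT.
have -> : Wcurve = fun t => coefv (pal_quartic 0 0) +
  expR t *: (- alpha0 *: quad_vec1) + expR (2 * t) *: quad_vec2.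
  by apply/funext => t; exact: WcurveE.
have cexp : rcont (@expR R) by split; exact: continuous_expR.
apply: continuous_vec => //; apply: rcont_comp => //.
exact: rcont_mul (rcont_cst _) (rcont_id R).
Qed.

Lemma family_noncompact : ~ compact (@coefv R @` family).
Proof.
move=> cpt; have : compact (height @` (@coefv R @` family)).
  by apply: continuous_compact => //; exact: continuous_subspaceT.
have -> : height @` (@coefv R @` family) = [set x | 0 < x].
  apply/seteqP; split.
    by move=> _ [_ [_ [x /= x0 <-] <-] <-]; rewrite heightE.
  move=> x /= x0; exists (coefv (Wente_poly alpha0 x)); last by rewrite heightE.
  by exists (Wente_poly alpha0 x) => //; exists x.
move=> /compact_bounded[M [_ hM]].
have /hM /(_ (`|M| + 2)) : M < `|M| + 1 by rewrite (le_lt_trans (ler_norm M))// ltrDl.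
have p2 : 0 < `|M| + 2 by rewrite ltr_wpDl.
by move=> /(_ p2) /=; rewrite (gtr0_norm p2) lerD2l => h; lra.
Qed.

Let derivative_form k t : 'rV[R]_5 := (k == 0%N)%:R *: coefv (pal_quartic 0 0) +
  expR t *: (- alpha0 *: quad_vec1) + (2 ^+ k * expR (2 * t)) *: quad_vec2.

Let is_derive_form k (t : R) :
  is_derive t 1 (derivative_form k) (derivative_form k.+1 t).
Proof.
have d2 : is_derive t 1 (fun s : R => 2 ^+ k * expR (2 * s))
    (2 ^+ k.+1 * expR (2 * t)).
  have dl : is_derive t 1 (fun s : R => 2 * s) 2.
    apply: (is_derive_ext _ _ (is_derive_mul (is_derive_cst (2 : R) t 1)
      (is_derive_id t 1))) => //.
    by rewrite mul0r add0r mulr1.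
  apply: (is_derive_ext _ _ (is_derive_mul (is_derive_cst (2 ^+ k : R) t 1)
    (is_derive_comp (is_derive_expR _) dl))) => //.
  by rewrite /cst exprS; ring.
have := is_deriveD (is_deriveD
  (is_derive_cst ((k == 0)%:R *: coefv (pal_quartic 0 0)) t 1)
  (is_derive_scale_vec (- alpha0 *: quad_vec1) (is_derive_expR t)))
  (is_derive_scale_vec quad_vec2 d2).
by rewrite {2}/derivative_form scale0r.
Qed.

Let Wcurve_derive1n k : (Wcurve^`(k))%classic = derivative_form k.
Proof.
elim: k => [|k IH].
  apply/funext => t; rewrite derive1n0 WcurveE /derivative_form.
  by rewrite scale1r expr0 mul1r.
apply/funext => t; rewrite derive1nS IH derive1E.
exact: (@derive_val _ _ _ _ _ _ _ (is_derive_form k t)).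
Qed.

Let open_height (I : set R) : open I ->
  open [set v | 0 < height v /\ I (ln (height v))].
Proof.
move=> oI; rewrite -[X in open X]/(height @^-1` [set x | 0 < x /\ I (ln x)]).
apply: open_comp; first by move=> v _; exact: height_continuous.
rewrite openE => x [x0 Ix]; rewrite /interior /=.
have h1 : \forall y \near x, I (ln y).
  by apply: (continuous_ln x0); exact: open_nbhs_nbhs.
have h2 : \forall y \near x, 0 < y by exact: lt_nbhsr.
by near=> y; split; near: y.
Unshelve. all: by end_near. Qed.

(** One global chart suffices. An open set of parameters is cut out by a condition on [height], and
    the velocity is nonzero because its entry of index 1 is -alpha0 exp t. *)
Lemma family_submanifold : submanifold1 (@coefv R @` family).
Proof.
have a0 : 0 < alpha0 by case/andP: alpha0_bounds.
move=> v _; exists setT, Wcurve; split.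
- by split; first exact: openT.
- split=> [k t|t].
    by rewrite Wcurve_derive1n; exact: (@ex_derive _ _ _ _ _ _ _ (is_derive_form k t)).
  rewrite -derive1n1 Wcurve_derive1n; apply/eqP => /rowP/(_ 1).
  rewrite !mxE /= => /eqP; rewrite mulr0 addr0 mul0r add0r mulr1.
  by rewrite mulf_eq0 oppr_eq0 !gt_eqF// expR_gt0.
- split; last by rewrite setIT WcurveP.
  by move=> t u tu; apply: expR_inj; rewrite -[LHS]heightE -/(Wcurve t) tu heightE.
- move=> I oI; exists [set v | 0 < height v /\ I (ln (height v))].
    exact: open_height.
  rewrite -WcurveP; apply/seteqP; split.
    move=> _ [t It <-]; split; first by exists t.
    by rewrite /= /Wcurve heightE expR_gt0 expRK.
  move=> _ [[t _ <-]] /=; rewrite /Wcurve heightE expRK => -[_ It].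
  by exists t.
Qed.

End Curve.
End Topology.

Theorem theorem6p2 (R : realType) (beta : R -> R) (alpha0 : R)
    (A_minus : set {poly R[i]})
    (beta_def : is_beta beta)
    (beta_incr : forall x y, -2 < x < 2 -> -2 < y < 2 -> x < y ->
       beta x < beta y)
    (alpha0_bounds : 0 < alpha0 < 2)
    (alpha0_root : unique (fun x => -2 < x < 2 /\ beta x = 0) alpha0)
    (A_minus_def : is_A_minus A_minus) :
  [/\ @Wente R = [set Wente_poly alpha0 alphap | alphap in [set r | 0 < r]],
    @Wente R `<=` A_minus,
    connected (@coefv R @` @Wente R),
    ~ compact (@coefv R @` @Wente R) &
    submanifold1 (@coefv R @` @Wente R)].
Proof.
have WE := WenteE beta_def alpha0_root; rewrite WE.
split=> //.
- move=> _ [ap /= ap0 <-]; rewrite Wente_polyE; apply: A_minus_pal_quartic => //.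
  case/andP: alpha0_bounds => al1 al2.
  by rewrite sqrrN exprMn ltr_pM2r ?exprn_gt0//; nra.
- exact: family_connected.
- exact: family_noncompact.
- exact: family_submanifold.
Qed.
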